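(* Let $\pi$ and $q$ be a target and a proposal density on $\mathbb{X}\subset\mathbb{R}^d$, let $F:\mathbb{X}\to\mathbb{R}$, and assume: (A1) the Markov chain produced by the independent Metropolis sampler $IM(P,\pi,q)$ is $\psi$-irreducible and aperiodic with unique invariant measure $\pi$; (A2) $F\in L^W_\infty$ and $W\in L_4^{\pi,q}$ for a function $W\ge 1$ on $\mathbb{X}$; (A3) $w^\star:=\sup_{x\in\mathbb{X}}\pi(x)/q(x)<\infty$. Then there exists a constant $\epsilon>0$ such that if $\mathbb{KL}(q(x)\,\|\,\pi(x))\le\epsilon$ then $$\sigma^2_{IMCV}\le\sigma^2_F\le\sigma^2_{IM}.$$
   Context: Setting: $\pi(x)=\frac1{\mathcal Z}\exp\{f(x)\}$ is a probability density on $\mathbb{X}\subset\mathbb{R}^d$ (with respect to $dx$), $q$ is a probability density on $\mathbb{X}$; $\pi$ and $q$ also denote the corresponding measures, and $\mathbb{E}_\pi,\mathbb{E}_q$ the corresponding expectations. Independent Metropolis sampler $IM(P,\pi,q)$: the Markov chain $(X_i)_{i\ge1}$ which at state $X_i$ draws $Y_i\sim q$ independently of the past and sets $X_{i+1}=Y_i$ with probability $\alpha(X_i,Y_i)$ and $X_{i+1}=X_i$ otherwise, where $\alpha(x,y)=\min\left(1,\frac{\pi(y)q(x)}{\pi(x)q(y)}\right)$ if $\pi(x)q(y)>0$ and $\alpha(x,y)=1$ otherwise. Its transition kernel is $P(x,dy)=\alpha(x,y)q(y)dy+\left(1-\int\alpha(x,z)q(z)dz\right)\delta_x(dy)$. Function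 spaces: for $W\ge1$ on $\mathbb{X}$, $L^W_\infty=\{f:\mathbb{X}\to\mathbb{R} : \sup_{x\in\mathbb{X}}|f(x)|/W(x)<\infty\}$; and $L_n^{\pi,q}=\{f:\mathbb{X}\to\mathbb{R} : \int_{\mathbb X}|f|^n\pi\,dx<\infty,\ \int_{\mathbb X}|f|^n q\,dx<\infty\}$. Estimators: $\mu_{n,IM}=\frac1n\sum_{i=1}^nF(X_i)$ and $$\mu_{n,IMCV}=\frac1n\sum_{i=1}^n\left\{F(X_i)+\alpha(X_i,Y_i)(F(Y_i)-F(X_i))-(F(Y_i)-\mathbb{E}_q[F])\right\}.$$ Variances: $\sigma_F^2=\mathbb{E}_\pi[(F-\mathbb{E}_\pi[F])^2]$; $\sigma^2_{IM}=\lim_{n\to\infty}n\,\mathbb{E}_\pi[(\mu_{n,IM}-\mathbb{E}_\pi[F])^2]$; $\sigma^2_{IMCV}=\lim_{n\to\infty}\mathrm{Var}_{\pi,q}[\sqrt n\,\mu_{n,IMCV}]$, where in the latter two the chain is at stationarity ($X_1\sim\pi$) and the proposals satisfy $Y_i\sim q$. Kullback–Leibler divergence: $\mathbb{KL}(q(x)\|\pi(x))=\int q(x)\log\frac{q(x)}{\pi(x)}dx$. *)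

(* Defs.v *)
From HB Require Import structures.
From mathcomp Require Import all_boot all_order all_algebra.
From mathcomp Require Import all_classical all_reals all_analysis.

Set Implicit Arguments.
Unset Strict Implicit.
Unset Printing Implicit Defensive.

Import Order.TTheory GRing.Theory Num.Theory.
Import numFieldNormedType.Exports.

Local Open Scope classical_set_scope.
Local Open Scope ring_scope.

(** Lebesgue measure on [R^d], with [R^d] rendered as [d.-tuple R]: the
    library puts the product (Borel) sigma-algebra on tuples but no product
    measure, so it is transported along [(x, t) |-> x :: t]. *)

Lemma product_sigma_finite d1 d2 (T1 : measurableType d1)
    (T2 : measurableType d2) (R : realType)
    (m1 : {sigma_finite_measure set T1 -> \bar R})
    (m2 : {sigma_finite_measure set T2 -> \bar R}) :
  sigma_finite setT (m1 \x m2)%E.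
Proof.
have /sigma_finiteP[F [TF ndF Foo]] := sigma_finiteT m1.
have /sigma_finiteP[G [TG ndG Goo]] := sigma_finiteT m2.
exists (fun n => F n `*` G n).
  rewrite -setXTT TF TG predeqE => -[x y]; split.
    move=> [/= [n _ Fnx] [k _ Gky]]; exists (maxn n k) => //; split.
    - by move: x Fnx; exact/subsetPset/ndF/leq_maxl.
    - by move: y Gky; exact/subsetPset/ndG/leq_maxr.
  by move=> [n _ []/= ? ?]; split; exists n.
move=> k; have [? ?] := Foo k; have [? ?] := Goo k.
split; first exact: measurableX.
by rewrite product_measure1E// lte_mul_pinfty// ge0_fin_numE.
Qed.

Section lebesgue_tuple.
Local Open Scope ereal_scope.
Context (R : realType).

(* [lebesgue_measure] lives on [measurableTypeR R], a copy of [R] with the same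
   measurable sets. *)
Local Notation RR := (measurableTypeR R).

Definition tcons n (p : RR * n.-tuple R) : n.+1.-tuple R :=
  [the n.+1.-tuple R of (p.1 : R) :: p.2].

Lemma measurable_tcons n : measurable_fun setT (@tcons n).
Proof.
apply: (@measurable_cons _ _ (RR * n.-tuple R)%type R
  (fun p => p.1 : R) n snd); last exact: measurable_snd.
by have := @measurable_fst _ _ RR (n.-tuple R).
Qed.

Definition tuncons n (t : n.+1.-tuple R) : RR * n.-tuple R :=
  (tnth t ord0 : R, [tuple of behead t]).

Lemma measurable_tuncons n : measurable_fun setT (@tuncons n).
Proof.
apply/measurable_fun_pairP; split; last exact: measurable_behead.
by have := @measurable_tnth _ R n.+1 ord0.
Qed.

Lemma tconsK n : cancel (@tcons n) (@tuncons n).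
Proof. by case=> x t; congr pair; exact: val_inj. Qed.

Section step.
Variables (n : nat) (m : {sigma_finite_measure set (n.-tuple R) -> \bar R}).

Definition lebesgue_tupleS : set (n.+1.-tuple R) -> \bar R :=
  pushforward (@lebesgue_measure R \x m) (@tcons n).

Let preim (A : set (n.+1.-tuple R)) : measurable A ->
  measurable (@tcons n @^-1` A).
Proof.
by move=> mA; rewrite -[X in measurable X]setTI; exact: measurable_tcons.
Qed.

Let lebesgue_tupleS0 : lebesgue_tupleS set0 = 0.
Proof. by rewrite /lebesgue_tupleS /pushforward preimage_set0 measure0. Qed.

Let lebesgue_tupleS_ge0 A : 0 <= lebesgue_tupleS A.
Proof.
exact: (measure_ge0 (@lebesgue_measure R \x m : {measure set _ -> \bar R})).
Qed.

Let lebesgue_tupleS_sigma_additive : semi_sigma_additive lebesgue_tupleS.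
Proof.
move=> G mG tG mUG; rewrite /lebesgue_tupleS /pushforward preimage_bigcup.
apply: measure_semi_sigma_additive.
- by move=> k; exact: preim.
- apply/trivIsetP => /= i j _ _ ij; rewrite -preimage_setI.
  by move/trivIsetP : tG => /(_ _ _ _ _ ij) ->//; rewrite preimage_set0.
- by rewrite -preimage_bigcup; exact: preim.
Qed.

HB.instance Definition _ := isMeasure.Build _ _ _ lebesgue_tupleS
  lebesgue_tupleS0 lebesgue_tupleS_ge0 lebesgue_tupleS_sigma_additive.

Let lebesgue_tupleS_sigma_finite : sigma_finite setT lebesgue_tupleS.
Proof.
have [G GT Goo] := product_sigma_finite (@lebesgue_measure R) m.
exists (fun k => @tuncons n @^-1` G k).
  by rewrite -preimage_bigcup -GT preimage_setT.
move=> k; have [mG Gk] := Goo k; split.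
  by rewrite -[X in measurable X]setTI; exact: measurable_tuncons.
rewrite /lebesgue_tupleS /pushforward (_ : _ @^-1` _ = G k)//.
by apply/seteqP; split=> x /=; rewrite tconsK.
Qed.

HB.instance Definition _ := Measure_isSigmaFinite.Build _ _ _ lebesgue_tupleS
  lebesgue_tupleS_sigma_finite.

End step.

Fixpoint lebesgue_tuple d : {sigma_finite_measure set (d.-tuple R) -> \bar R} :=
  match d with
  | 0 => \d_([tuple] : 0.-tuple R)
  | n.+1 => lebesgue_tupleS (lebesgue_tuple n)
  end.

End lebesgue_tuple.
Arguments lebesgue_tuple {R} d.

(** Markov chains on a state space [D] with transition function [K]; each
    [K x], [x \in D], is meant to be a probability measure carried by [D]. *)

Section markov_chain.
Local Open Scope ereal_scope.
Context dT (T : measurableType dT) (R : realType).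
Variables (D : set T) (K : T -> set T -> \bar R).

Fixpoint iter_kernel (n : nat) (x : T) (A : set T) : \bar R :=
  match n with
  | 0 => \d_x A
  | m.+1 => \int[K x]_(y in D) iter_kernel m y A
  end.

Definition irreducibility_measure (phi : {measure set T -> \bar R}) : Prop :=
  [/\ sigma_finite D phi, 0 < phi D &
    forall A, measurable A -> A `<=` D -> 0 < phi A ->
      forall x, D x -> exists n, 0 < iter_kernel n.+1 x A].

(* [psi] is a maximal irreducibility measure. *)
Definition psi_irreducible (psi : {measure set T -> \bar R}) : Prop :=
  irreducibility_measure psi /\
  forall phi : {measure set T -> \bar R}, irreducibility_measure phi ->
    forall A, measurable A -> A `<=` D -> psi A = 0 -> phi A = 0.

Definition is_cycle (psi : {measure set T -> \bar R}) (n : nat)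
    (E : nat -> set T) : Prop :=
  [/\ forall i, (i < n)%N -> measurable (E i) /\ E i `<=` D,
      trivIset `I_n E,
      forall i x, (i < n)%N -> E i x -> K x (E (i.+1 %% n)%N) = 1 &
      psi (D `\` \bigcup_(i < n) E i) = 0].

(* [D] itself is a 1-cycle, so the period, i.e. the largest length of a cycle,
   is 1 iff there is no longer cycle. *)
Definition aperiodic (psi : {measure set T -> \bar R}) : Prop :=
  forall n E, (1 < n)%N -> ~ is_cycle psi n E.

Definition invariant (mu : set T -> \bar R) : Prop :=
  forall A, measurable A -> A `<=` D -> \int[mu]_(x in D) K x A = mu A.

(* Uniqueness is among probability measures: invariant measures can always be
   rescaled. *)
Definition unique_invariant (mu : set T -> \bar R) : Prop :=
  invariant mu /\
  forall nu : probability T R, nu D = 1 -> invariant nu ->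
    forall A, measurable A -> A `<=` D -> nu A = mu A.

Definition irreducible_aperiodic_unique_invariant (mu : set T -> \bar R) :=
  (exists psi : {measure set T -> \bar R},
     psi_irreducible psi /\ aperiodic psi) /\
  unique_invariant mu.

End markov_chain.

(** Densities, moments and the independent Metropolis sampler on
    [D `<=` R^d].  Functions on [D] are total functions whose values outside
    [D] are irrelevant. *)

Section independent_metropolis.
Context (R : realType) (d : nat).
Local Notation T := (d.-tuple R).
Local Notation leb := (@lebesgue_tuple R d).
Variable D : set T.

Definition gibbs (f : T -> R) (Z : R) : T -> R := fun x => Z^-1 * expR (f x).

Definition prob_density (p : T -> R) : Prop :=
  [/\ measurable_fun D p, (forall x, D x -> 0 <= p x) &
      (\int[leb]_(x in D) (p x)%:E = 1)%E].

Definition density_measure (p : T -> R) (A : set T) : \bar R :=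
  (\int[leb]_(x in D `&` A) (p x)%:E)%E.

Definition mean (p F : T -> R) : R := \int[leb]_(x in D) (F x * p x).

Definition in_LW (W F : T -> R) : Prop :=
  measurable_fun D F /\
  (ereal_sup [set (`|F x| / W x)%:E | x in D] < +oo)%E.

Definition abs_moment (n : nat) (p F : T -> R) : \bar R :=
  (\int[leb]_(x in D) (`|F x| ^+ n * p x)%:E)%E.

Definition in_Ln (n : nat) (pi q F : T -> R) : Prop :=
  [/\ measurable_fun D F, (abs_moment n pi F < +oo)%E &
      (abs_moment n q F < +oo)%E].

(* The quotients are taken in [\bar R], where [a / 0 = +oo] for [0 < a] and
   [0 / 0 = 0]. *)
Definition wstar (pi q : T -> R) : \bar R :=
  ereal_sup [set ((pi x)%:E / (q x)%:E)%E | x in D].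

(* In [\bar R], with [0 * log 0 = 0] and [a * log (a / 0) = +oo] for
   [0 < a]. *)
Definition KL (q pi : T -> R) : \bar R :=
  (\int[leb]_(x in D) ((q x)%:E * lne ((q x)%:E / (pi x)%:E)))%E.

Variables pi q : T -> R.

Definition accept (x y : T) : R :=
  if 0 < pi x * q y then Num.min 1 (pi y * q x / (pi x * q y)) else 1.

Definition IM_kernel (x : T) (A : set T) : \bar R :=
  (\int[leb]_(y in D `&` A) (accept x y * q y)%:E +
   (1 - \int[leb]_(z in D) (accept x z * q z)%:E) * \d_x A)%E.

Section chain.
Context dO (Om : measurableType dO) (P : probability Om R).
Variables X Y : nat -> {RV P >-> T}.

(* Events generated by [X 0, ..., X n] and [Y 0, ..., Y n.-1]. *)
Definition past (n : nat) : set (set Om) :=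
  <<s [set S | exists i A, measurable A /\
        (((i <= n)%N /\ S = X i @^-1` A) \/ ((i < n)%N /\ S = Y i @^-1` A))] >>.

(* Time starts at 0 instead of 1, and the chain is started at stationarity.
   The last clause is the conditional law of [(Y n, X n.+1)] given the past:
   [Y n] has density [q], and given the past and [Y n = y], the next state
   is [y] with probability [accept (X n) y] and [X n] otherwise. *)
Definition IM_chain : Prop :=
  [/\ forall n w, D (X n w) /\ D (Y n w),
      forall A, measurable A -> P (X 0%N @^-1` A) = density_measure pi A &
      forall n H B C, past n H -> measurable B -> measurable C ->
        P (H `&` (Y n @^-1` B) `&` (X n.+1 @^-1` C)) =
        (\int[P]_(w in H) \int[leb]_(y in D `&` B)
           (q y * (accept (X n w) y * \1_C y +
                   (1 - accept (X n w) y) * \1_C (X n w)))%:E)%E].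

Variable F : T -> R.

Definition mu_IM (n : nat) (w : Om) : R :=
  n%:R^-1 * \sum_(i < n) F (X i w).

Definition mu_IMCV (n : nat) (w : Om) : R :=
  n%:R^-1 * \sum_(i < n)
    (F (X i w) + accept (X i w) (Y i w) * (F (Y i w) - F (X i w))
     - (F (Y i w) - mean q F)).

Definition nmse_IM (n : nat) : \bar R :=
  (n%:R%:E * 'E_P[fun w => ((mu_IM n w - mean pi F) ^+ 2)%R])%E.

Definition nvar_IMCV (n : nat) : \bar R :=
  'V_P[fun w => (Num.sqrt n%:R * mu_IMCV n w)%R]%E.

Definition sigma2_IM : \bar R := limn nmse_IM.

Definition sigma2_IMCV : \bar R := limn nvar_IMCV.

End chain.

Definition sigma2 (F : T -> R) : \bar R :=
  (\int[leb]_(x in D) ((F x - mean pi F) ^+ 2 * pi x)%:E)%E.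

End independent_metropolis.

(* Main.v *)
(** Write [w = pi / q], so that [pi = w . q] with [0 < w <= B], and put every
    integral on the proposal law [Q].  On L^2([Q]) the Metropolis operator is
      [P g x = \int (a(x, y) g(y) + (1 - a(x, y)) g(x)) dQ(y)],
      [w(x) a(x, y) = min(w(x), w(y))].
    Three facts drive the comparison.
    - [P] is reversible and positive for [pi], because
      [min(s, t) = \int 1_[0, s[ 1_[0, t[]; so the autocovariances of [F(X_n)]
      are nonnegative, which gives [sigma_F^2 <= sigma_IM^2].
    - [a(x, y) >= w(y) / B] (Doeblin), so [P] contracts centred functions of
      L^2([pi]) by [1 - 1 / B].  Hence, for a centred stationary sequence
      [xi_n = U(X_n, Y_n)], the lag-k covariance is at most
      [E[xi^2] (1 - 1 / B)^(k - 1)], the normalised variances of the partial sums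
      converge, and their limit is at most [E[xi^2] (1 + 2 B)].
    - The [n]-th IMCV summand is, up to the constant [E_q[F]], the rejection term
      [(1 - a(X_n, Y_n)) (F(X_n) - F(Y_n))].  Its second moment is bounded by the
      fourth moments of [F] and by [\int |w - 1| dQ], which is small when
      [KL(q || pi)] is. *)

Require Import Defs.
From HB Require Import structures.
From mathcomp Require Import all_boot all_order all_algebra.
From mathcomp Require Import all_classical all_reals all_analysis measurable_realfun.
From mathcomp Require Import finmap ring lra.
Set Implicit Arguments.
Unset Strict Implicit.
Unset Printing Implicit Defensive.
Import Order.TTheory GRing.Theory Num.Theory.
Import numFieldNormedType.Exports.
Local Open Scope classical_set_scope.
Local Open Scope ring_scope.

(** * Measure-theoretic preliminaries *)

(** [eps] is chosen before [q], so the bounds on the rejection term may depend on [q] only through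
    [wbar], [mbar] and the divergence. Since [F] may be unbounded, [\int |w - 1| dQ] alone does not
    control that term: the squares [(F x - F y)^2] are compared with a level [K], the excess is paid
    for by fourth moments at a price of order [1 / K], and [K] is fixed before [eps]. This needs
    [sigma_F^2 > 0]; if [sigma_F^2 = 0], then [F] is almost everywhere constant and the rejection
    term vanishes whatever [q] is. The IMCV summand involves [Y_n] as well as [X_n], so positivity
    of [P] says nothing about its covariances. Only their geometric decay is used there, and the
    loss of a factor [1 + 2 B] is harmless because the second moment is made small. The chain is
    given only through probabilities of events [H], [Y_n \in A], [X_(n+1) \in C]. No conditional
    expectation is formed: identities are extended from indicators to nonnegative functions by
    monotone limits, then to signed ones by writing [f = (f + |f|) - |f|], which stays within
    integrable functions. *)

Section measurable_induction.
Import HBNNSimple.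
Context d (T : measurableType d) (R : realType).

(** The passage from indicators to simple functions to monotone limits, packaged once because it
    serves both changes of density and one-step expectations of the chain. *)
Lemma ge0_measurable_ind (K : (T -> R) -> Prop) :
  (forall A, measurable A -> K \1_A) ->
  (forall (k : R) (f : T -> R), 0 <= k -> measurable_fun setT f -> (forall x, 0 <= f x) ->
     K f -> K (fun x => k * f x)) ->
  (forall f g : T -> R, measurable_fun setT f -> (forall x, 0 <= f x) ->
     measurable_fun setT g -> (forall x, 0 <= g x) ->
     K f -> K g -> K (fun x => f x + g x)) ->
  (forall (h : nat -> T -> R) (f : T -> R), (forall n, measurable_fun setT (h n)) ->
     (forall n x, 0 <= h n x) -> (forall x, {homo h^~ x : m n / (m <= n)%N >-> m <= n}) ->
     (forall x, h n x @[n --> \oo] --> f x) -> (forall n, K (h n)) -> K f) ->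
  forall f : T -> R, measurable_fun setT f -> (forall x, 0 <= f x) -> K f.
Proof.
move=> K1 KZ KD KL f mf f0.
have mEf : measurable_fun [set: T] (fun x => (f x)%:E) by exact/measurable_EFinP.
pose h := nnsfun_approx measurableT mEf.
refine (KL (fun n x => h n x) f _ _ _ _ _).
- by move=> n; exact: measurable_funPT.
- by move=> n x; exact: fun_ge0.
- by move=> x m n mn; have /lefP/(_ x) := nd_nnsfun_approx measurableT mEf mn.
- move=> x.
  have /= := cvg_nnsfun_approx measurableT mEf (fun t _ => f0 t : (0 <= (f t)%:E)%E) (I : [set: T] x).
  by move/fine_cvgP => -[_]; apply: cvg_trans; apply: near_eq_cvg; near=> n.
- move=> n.
  (* An arbitrary list of values replaces the full range, so that the induction can run over the
     list. *)
  have Ksum (s : seq R) : {subset s <= range (h n)} ->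
      K (fun x => \sum_(y <- s) y * \1_(h n @^-1` [set y]) x).
  { elim: s => [_|y s ih sub].
      rewrite (_ : (fun x => _) = \1_set0); first exact: K1.
      by apply/funext=> x; rewrite big_nil indic0.
    rewrite (_ : (fun x => _) = fun x => y * \1_(h n @^-1` [set y]) x +
      \sum_(i <- s) i * \1_(h n @^-1` [set i]) x); last first.
      by apply/funext => x; rewrite big_cons.
    have range0 i : i \in range (h n) -> 0 <= i.
      by move=> /set_mem[z _ <-]; exact: fun_ge0.
    have y0 : 0 <= y by apply: range0; apply: sub; rewrite mem_head.
    have s0 i : i \in s -> 0 <= i.
      by move=> si; apply: range0; apply: sub; rewrite inE si orbT.
    have mind i : measurable_fun setT (fun x => i * \1_(h n @^-1` [set i]) x : R).
      by apply: measurable_funM => //; exact: measurable_indic.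
    apply: KD => //.
    + by move=> x; rewrite mulr_ge0.
    + exact: measurable_sum.
    + by move=> x; rewrite big_seq sumr_ge0// => i /s0 ?; rewrite mulr_ge0.
    + by apply: KZ => //; exact: K1.
    + by apply: ih => i si; apply: sub; rewrite inE si orbT. }
  rewrite (_ : (fun x => _) = fun x => \sum_(y <- fset_set (range (h n)))
      y * \1_(h n @^-1` [set y]) x).
    by apply: Ksum => y; rewrite in_fset_set.
  by apply/funext=> x; rewrite fimfunE fsbig_finite.
Unshelve. all: by end_near. Qed.

End measurable_induction.

Section densities.
Context d (T : measurableType d) (R : realType).
Implicit Types (mu nu : {measure set T -> \bar R}).

Lemma ge0_cvg_integral_EFin mu (h : nat -> T -> R) (f : T -> R) :
  (forall n, measurable_fun setT (h n)) -> (forall n x, 0 <= h n x) ->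
  (forall x, {homo h^~ x : m n / (m <= n)%N >-> m <= n}) ->
  (forall x, h n x @[n --> \oo] --> f x) ->
  (\int[mu]_x (h n x)%:E @[n --> \oo] --> \int[mu]_x (f x)%:E)%E.
Proof.
move=> mh h0 hnd hf.
have hlim x : limn (fun n => (h n x)%:E) = (f x)%:E.
  by apply/cvg_lim => //; apply: cvg_EFin (hf x); apply: nearW.
rewrite (_ : (fun x => (f x)%:E) = fun x => limn (fun n => (h n x)%:E)); last first.
  by apply/funext => x; rewrite hlim.
apply: cvg_monotone_convergence => //.
- by move=> n; exact/measurable_EFinP.
- by move=> n x _; rewrite lee_fin.
- by move=> x _ m n mn; rewrite lee_fin hnd.
Qed.

Lemma integral_density mu nu (k : T -> R) :
  measurable_fun setT k -> (forall x, 0 <= k x) ->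
  (forall A, measurable A -> nu A = \int[mu]_(x in A) (k x)%:E)%E ->
  forall f : T -> R, measurable_fun setT f -> (forall x, 0 <= f x) ->
  (\int[nu]_x (f x)%:E = \int[mu]_x (f x * k x)%:E)%E.
Proof.
move=> mk k0 nuE.
apply: (@ge0_measurable_ind _ _ _ (fun f : T -> R =>
  \int[nu]_x (f x)%:E = \int[mu]_x (f x * k x)%:E)%E).
- move=> A mA; rewrite integral_indic// setIT nuE// integral_mkcond.
  by apply: eq_integral => x _; rewrite epatch_indic/= muleC.
- move=> c f c0 mf f0 fE; under eq_integral do rewrite EFinM.
  rewrite ge0_integralZl_EFin//; last exact/measurable_EFinP.
  rewrite fE -ge0_integralZl_EFin//.
  + by apply: eq_integral => x _; rewrite -EFinM mulrA.
  + by move=> x _; rewrite lee_fin mulr_ge0.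
  + by apply/measurable_EFinP; exact: measurable_funM.
  + by move=> x _; rewrite lee_fin.
- move=> f g mf f0 mg g0 fE gE; under eq_integral do rewrite EFinD.
  rewrite ge0_integralD//; try by exact/measurable_EFinP.
  rewrite fE gE -ge0_integralD//.
  + by apply: eq_integral => x _; rewrite -EFinD mulrDl.
  + by move=> x _; rewrite lee_fin mulr_ge0.
  + by apply/measurable_EFinP; exact: measurable_funM.
  + by move=> x _; rewrite lee_fin mulr_ge0.
  + by apply/measurable_EFinP; exact: measurable_funM.
  + by move=> x _; rewrite lee_fin.
  + by move=> x _; rewrite lee_fin.
- move=> h f mh h0 hnd hf hE.
  have c1 := @ge0_cvg_integral_EFin nu _ _ mh h0 hnd hf.
  have c2 : (\int[mu]_x (h n x * k x)%:E @[n --> \oo] -->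
      \int[mu]_x (f x * k x)%:E)%E; last first.
    rewrite -(cvg_lim _ c1)// -(cvg_lim _ c2)//.
    by congr (limn _); apply/funext => n; exact: hE.
  apply: ge0_cvg_integral_EFin => //.
  + by move=> n; exact: measurable_funM.
  + by move=> n x; rewrite mulr_ge0.
  + by move=> x m n mn; rewrite ler_wpM2r// hnd.
  + by move=> x; apply: cvgMr_tmp; exact: hf.
Qed.

End densities.

Section product_uniqueness.
Context d1 d2 (T1 : measurableType d1) (T2 : measurableType d2) (R : realType).

(** Rectangles form a pi-system generating the product sigma-algebra; as the total mass is finite,
    the constant sequence [setT] serves as exhaustion. *)
Lemma eq_measure_rect (m1 m2 : {measure set (T1 * T2)%type -> \bar R}) :
  (m1 setT < +oo)%E ->
  (forall A B, measurable A -> measurable B -> m1 (A `*` B) = m2 (A `*` B)) ->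
  forall E, measurable E -> m1 E = m2 E.
Proof.
move=> m1oo m12.
pose C : set (set (T1 * T2)%type) :=
  [set C | exists A, measurable A /\ exists B, measurable B /\ C = A `*` B].
apply: (measure_unique C (fun n => setT)) => //.
- rewrite measurable_prod_measurableType //; congr (<<s _ >>).
  rewrite predeqE; split => [[A mA [B mB <-]]|[A [mA [B [mB ->]]]]].
    by exists A; split => //; exists B.
  by exists A => //; exists B.
- move=> /= _ _ [X1 [mX1 [X2 [mX2 ->]]]] [Y1 [mY1 [Y2 [mY2 ->]]]].
  rewrite -setXI; exists (X1 `&` Y1); split; first exact: measurableI.
  by exists (X2 `&` Y2); split => //; exact: measurableI.
- by move=> i; exists setT; split => //; exists setT; rewrite setXTT.
- by rewrite bigcup_const.
- by move=> A [A1 [mA1 [A2 [mA2 ->]]]]; exact: m12.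
Qed.

End product_uniqueness.

Notation intg mu f := (mu.-integrable setT (EFin \o f)).

Section integrable_real.
Context d (T : measurableType d) (R : realType).
Variable mu : {measure set T -> \bar R}.
Implicit Types f g : T -> R.

Lemma intg_mfun f : intg mu f -> measurable_fun setT f.
Proof. by move=> /measurable_int/measurable_EFinP. Qed.

Lemma le_intg f g : measurable_fun setT f -> (forall x, `|f x| <= g x) ->
  intg mu g -> intg mu f.
Proof.
move=> mf fg; apply: le_integrable => //; first exact/measurable_EFinP.
by move=> x _ /=; rewrite lee_fin (le_trans (fg x))// ler_norm.
Qed.

Lemma EFin_Rintegral f : intg mu f ->
  (\int[mu]_x f x)%:E = (\int[mu]_x (f x)%:E)%E.
Proof.
by move=> jf; rewrite /Rintegral fineK//; exact: (integrable_fin_num measurableT jf).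
Qed.

Lemma intgD f g : intg mu f -> intg mu g -> intg mu (fun x => f x + g x).
Proof. by move=> i j; exact: (integrableD measurableT i j). Qed.

Lemma intgB f g : intg mu f -> intg mu g -> intg mu (fun x => f x - g x).
Proof. by move=> i j; exact: (integrableB measurableT i j). Qed.

Lemma intgZ c f : intg mu f -> intg mu (fun x => c * f x).
Proof. by move=> i; exact: (integrableZl measurableT c i). Qed.

Lemma intg_bounded (b : T -> R) f : measurable_fun setT b -> (forall x, `|b x| <= 1) ->
  intg mu f -> intg mu (fun x => b x * f x).
Proof.
move=> mb b1 sf; apply: (le_intg _ _ (integrable_norm sf)).
  by apply: measurable_funM => //; exact: intg_mfun.
by move=> x; rewrite normrM ler_piMl.
Qed.

End integrable_real.

Section square_integrable.
Context d (T : measurableType d) (R : realType).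
Variable mu : {finite_measure set T -> \bar R}.
Implicit Types f g : T -> R.

(** Measurability of [f] is a separate clause because that of its square does not imply it. *)
Definition sqint f := measurable_fun setT f /\ intg mu (fun x => f x ^+ 2).

Lemma intg_cst c : intg mu (fun=> c).
Proof. exact: finite_measure_integrable_cst. Qed.

Lemma sqintM f g : sqint f -> sqint g -> intg mu (fun x => f x * g x).
Proof.
move=> [mf f2] [mg g2]; apply: (le_intg _ _ (intgD f2 g2)).
  exact: measurable_funM.
move=> x; rewrite ler_norml; apply/andP; split.
  have := sqr_ge0 (f x + g x); have := sqr_ge0 (f x); have := sqr_ge0 (g x); nra.
have := sqr_ge0 (f x - g x); have := sqr_ge0 (f x); have := sqr_ge0 (g x); nra.
Qed.

Lemma sqint_cst c : sqint (fun=> c).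
Proof. by split => //; exact: intg_cst. Qed.

Lemma sqint_intg f : sqint f -> intg mu f.
Proof.
move=> sf; have := sqintM sf (sqint_cst 1).
by under eq_fun do rewrite mulr1.
Qed.

Lemma sqint_le f g : measurable_fun setT f -> sqint g ->
  (forall x, `|f x| <= `|g x|) -> sqint f.
Proof.
move=> mf [mg g2] fg; split => //; apply: le_intg g2.
  exact: measurable_funX.
by move=> x; rewrite normrX -(real_normK (num_real (g x))) lerXn2r ?nnegrE.
Qed.

Lemma sqintD f g : sqint f -> sqint g -> sqint (fun x => f x + g x).
Proof.
move=> sf sg; split; first by apply: measurable_funD; [case: sf|case: sg].
have := intgD (intgD sf.2 sg.2) (intgZ 2 (sqintM sf sg)).
apply: eq_integrable => // x _ /=; congr EFin; ring.
Qed.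

Lemma sqint_sum n (f : nat -> T -> R) : (forall i, sqint (f i)) ->
  sqint (fun x => \sum_(i < n) f i x).
Proof.
move=> sf; elim: n => [|n ih].
  by under eq_fun do rewrite big_ord0; exact: sqint_cst.
by under eq_fun do rewrite big_ord_recr; exact: sqintD.
Qed.

Lemma sqintZ c f : sqint f -> sqint (fun x => c * f x).
Proof.
move=> [mf f2]; split; first exact: measurable_funM.
have := intgZ (c ^+ 2) f2.
by apply: eq_integrable => // x _ /=; rewrite exprMn.
Qed.

Lemma sqintB f g : sqint f -> sqint g -> sqint (fun x => f x - g x).
Proof.
move=> sf /(sqintZ (-1)) sg; have := sqintD sf sg.
by under eq_fun do rewrite mulN1r.
Qed.

Lemma sqint_norm f : sqint f -> sqint (fun x => `|f x|).
Proof.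
move=> sf; apply: (sqint_le _ sf); last by move=> x; rewrite normr_id.
by apply: measurableT_comp => //; case: sf.
Qed.

Lemma sqint_bounded (b : T -> R) f : measurable_fun setT b -> (forall x, `|b x| <= 1) ->
  sqint f -> sqint (fun x => b x * f x).
Proof.
move=> mb b1 sf; apply: (sqint_le _ sf); first by apply: measurable_funM => //; case: sf.
by move=> x; rewrite normrM ler_piMl.
Qed.

(** Young's inequality with a free weight. It stands in for Cauchy-Schwarz without square roots: the
    weight is later tuned to the decay rate of the covariances. *)
Lemma normr_Rintegral_prod_le s f g : 0 < s -> sqint f -> sqint g ->
  `|\int[mu]_x (f x * g x)| <=
  2^-1 * (s * \int[mu]_x (f x ^+ 2) + s^-1 * \int[mu]_x (g x ^+ 2)).
Proof.
move=> s0 sf sg; have [mf f2] := sf; have [mg g2] := sg.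
have fg := sqintM sf sg.
rewrite -!RintegralZl// -RintegralD//; [|exact: intgZ..].
rewrite -RintegralZl//; last by apply: intgD; exact: intgZ.
apply: (le_trans (le_normr_Rintegral _ _)) => //.
apply: le_Rintegral => //.
- exact: integrable_norm.
- by apply: intgZ; apply: intgD; exact: intgZ.
- move=> x _; rewrite ler_norml.
  have -> : 2^-1 * (s * f x ^+ 2 + s^-1 * g x ^+ 2) =
     2^-1 * s * ((f x) ^+ 2 + (g x / s) ^+ 2).
    by field; rewrite gt_eqF.
  have -> : f x * g x = s * (f x * (g x / s)) by field; rewrite gt_eqF.
  set a := f x; set b := g x / s.
  have := sqr_ge0 (a + b); have := sqr_ge0 (a - b) => h1 h2.
  apply/andP; split; nra.
Qed.
  
End square_integrable.

Lemma Rintegral_centered d (T : measurableType d) (R : realType)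
    (mu : probability T R) (g : T -> R) (m : R) : sqint mu g -> m = \int[mu]_x g x ->
  \int[mu]_x ((g x - m) ^+ 2) = \int[mu]_x (g x ^+ 2) - m ^+ 2.
Proof.
move=> sg mE; have [mg g2] := sg; have jg := sqint_intg sg.
rewrite (_ : \int[mu]_x _ =
    \int[mu]_x (g x ^+ 2 + ((- (2 * m)) * g x + m ^+ 2))); last first.
  by apply: eq_Rintegral => x _; ring.
have jmg := intgZ (- (2 * m)) jg; have jm := intg_cst mu (m ^+ 2).
rewrite RintegralD//; last exact: intgD.
have muT : fine (mu setT) = 1 by rewrite probability_setT.
by rewrite RintegralD// RintegralZl// Rintegral_cst// muT -mE; ring.
Qed.

Lemma sqr_Rintegral_le d (T : measurableType d) (R : realType)
    (mu : probability T R) (g : T -> R) : sqint mu g ->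
  (\int[mu]_x g x) ^+ 2 <= \int[mu]_x (g x ^+ 2).
Proof.
move=> sg; rewrite -subr_ge0 -(Rintegral_centered sg erefl).
by apply: Rintegral_ge0 => x _; exact: sqr_ge0.
Qed.

Section fubini_Rintegral.
Context d1 d2 (T1 : measurableType d1) (T2 : measurableType d2) (R : realType).
Variables (m1 : {sigma_finite_measure set T1 -> \bar R})
  (m2 : {sigma_finite_measure set T2 -> \bar R}).
Implicit Types phi : T1 * T2 -> R.

(** Fubini yields integrable sections only almost everywhere. Asking for all of them makes the inner
    real integral agree with the extended one at every point. *)
Lemma Rintegral12 phi : intg (m1 \x m2)%E phi ->
  (forall x, intg m2 (fun y => phi (x, y))) ->
  intg m1 (fun x => \int[m2]_y phi (x, y)) /\
  \int[m1]_x \int[m2]_y phi (x, y) = \int[(m1 \x m2)%E]_p phi p.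
Proof.
move=> iphi iphix.
have E x : (\int[m2]_y phi (x, y))%:E = (\int[m2]_y (phi (x, y))%:E)%E.
  exact: (EFin_Rintegral (iphix x)).
split.
  have := integrable_fubini_F iphi.
  by apply: eq_integrable => // x _; rewrite /= E.
rewrite /Rintegral -(integral12_prod_meas1 iphi); congr fine.
by apply: eq_integral => x _; rewrite E.
Qed.

Lemma Rintegral21 phi : intg (m1 \x m2)%E phi ->
  (forall y, intg m1 (fun x => phi (x, y))) ->
  measurable_fun setT (fun y => \int[m1]_x phi (x, y)) /\
  \int[m2]_y \int[m1]_x phi (x, y) = \int[(m1 \x m2)%E]_p phi p.
Proof.
move=> iphi iphix.
have E x : (\int[m1]_y phi (y, x))%:E = (\int[m1]_y (phi (y, x))%:E)%E.
  exact: (EFin_Rintegral (iphix x)).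
split.
  apply/measurable_EFinP.
  rewrite (_ : EFin \o _ = fun y => \int[m1]_x (phi (x, y))%:E)%E.
    exact: measurable_fubini_G iphi.
  by apply/funext => y; exact: E.
rewrite /Rintegral -(integral21_prod_meas1 iphi); congr fine.
by apply: eq_integral => x _; rewrite E.
Qed.

Lemma Rintegral_swap phi : intg (m1 \x m2)%E phi ->
  (forall x, intg m2 (fun y => phi (x, y))) ->
  (forall y, intg m1 (fun x => phi (x, y))) ->
  \int[m1]_x \int[m2]_y phi (x, y) = \int[m2]_y \int[m1]_x phi (x, y).
Proof. by move=> h /(Rintegral12 h)[_ ->] /(Rintegral21 h)[_ ->]. Qed.

Lemma intg_prodM (f : T1 -> R) (g : T2 -> R) : intg m1 f -> intg m2 g ->
  intg (m1 \x m2)%E (fun p => f p.1 * g p.2).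
Proof.
move=> jf jg; have mf := intg_mfun jf; have mg := intg_mfun jg.
apply/integrable12ltyP.
  apply/measurable_EFinP; apply: measurable_funM.
    by apply: measurableT_comp => //.
  by apply: measurableT_comp => //.
under eq_integral => x _.
  under eq_integral do rewrite /= normrM EFinM.
  rewrite ge0_integralZl_EFin//; last first.
    by apply/measurable_EFinP; exact: measurableT_comp.
  over.
have /integrableP[_ jf'] := jf; have /integrableP[_ jg'] := jg.
rewrite ge0_integralZr//.
- by apply: lte_mul_pinfty => //; [exact: integral_ge0|rewrite ge0_fin_numE//; exact: integral_ge0].
- by apply/measurable_EFinP; exact: measurableT_comp.
- exact: integral_ge0.
Qed.

Let measurable_ge0_Rintegral2 (phi : T1 * T2 -> R) : measurable_fun setT phi ->
  (forall p, 0 <= phi p) -> (forall v, intg m2 (fun y => phi (v, y))) ->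
  measurable_fun setT (fun v => \int[m2]_y phi (v, y)).
Proof.
move=> mphi phi0 jv; apply/measurable_EFinP.
rewrite (_ : EFin \o _ = fun v => \int[m2]_y (phi (v, y))%:E)%E; last first.
  by apply/funext => v; exact: (EFin_Rintegral (jv v)).
apply: (measurable_fun_fubini_tonelli_F (fun p => (phi p)%:E)) => //.
exact/measurable_EFinP.
Qed.

(** No joint integrability is assumed, so Tonelli is applied to the nonnegative functions
    [phi + |phi|] and [|phi|], and the results are subtracted. *)
Lemma measurable_Rintegral2 (phi : T1 * T2 -> R) : measurable_fun setT phi ->
  (forall v, intg m2 (fun y => phi (v, y))) ->
  measurable_fun setT (fun v => \int[m2]_y phi (v, y)).
Proof.
move=> mphi jv.
have jn v : intg m2 (fun y => `|phi (v, y)|) by exact: integrable_norm.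
have jD v : intg m2 (fun y => phi (v, y) + `|phi (v, y)|) by exact: intgD.
have mn : measurable_fun setT (fun p => `|phi p|) by exact: measurableT_comp.
rewrite (_ : (fun v => _) = fun v => \int[m2]_y (phi (v, y) + `|phi (v, y)|) -
    \int[m2]_y `|phi (v, y)|); last first.
  apply/funext => v; rewrite -RintegralB//.
  by apply: eq_Rintegral => y _; rewrite addrK.
apply: measurable_funB.
  apply: (measurable_ge0_Rintegral2 (phi := fun p => phi p + `|phi p|)) => //.
    exact: measurable_funD.
  by move=> p; rewrite -lerBlDl sub0r -normrN ler_norm.
exact: (measurable_ge0_Rintegral2 (phi := fun p => `|phi p|)).
Qed.

End fubini_Rintegral.

Lemma measurable_funV d (T : measurableType d) (R : realType) (f : T -> R) :
  measurable_fun setT f -> (forall x, 0 < f x) ->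
  measurable_fun setT (fun x => (f x)^-1).
Proof.
move=> mf f0; rewrite (_ : (fun x => _) = (@powR R)^~ (-1) \o f).
  exact: (measurableT_comp (measurable_powR (-1)) mf).
by apply/funext => x /=; rewrite powR_inv1// ltW.
Qed.

Lemma intg_mulB d (T : measurableType d) (R : realType)
    (mu : {measure set T -> \bar R}) (B : R) (b f : T -> R) :
  0 < B -> measurable_fun setT b -> (forall x, 0 <= b x <= B) -> intg mu f ->
  intg mu (fun x => b x * f x).
Proof.
move=> B_gt0 mb bB jf.
have := intgZ B (intg_bounded (b := fun x => b x / B) _ _ jf).
rewrite (_ : (fun x => B * _) = fun x => b x * f x); first apply.
- exact: measurable_funM.
- move=> x; have /andP[? ?] := bB x.
  by rewrite ger0_norm ?divr_ge0 ?(ltW B_gt0)// ler_pdivrMr// mul1r.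
- by apply/funext => x; field; rewrite gt_eqF.
Qed.

(** * The Metropolis operator on square-integrable functions *)

Section metropolis_operator.
Context d (T : measurableType d) (R : realType).
Variables (Q : probability T R) (w : T -> R) (B : R).
Hypotheses (mw : measurable_fun setT w) (w_gt0 : forall x, 0 < w x)
  (wB : forall x, w x <= B) (w1 : \int[Q]_x w x = 1) (B1 : 1 < B).
Implicit Types f g : T -> R.

Let fineQT : fine (Q setT) = 1.
Proof. by rewrite probability_setT. Qed.

Let B_gt0 : 0 < B. Proof. exact: lt_trans B1. Qed.

Definition acc x y := Num.min 1 (w y / w x).

Definition metropolis g x := \int[Q]_y (acc x y * g y + (1 - acc x y) * g x).

Lemma acc_ge0 x y : 0 <= acc x y.
Proof. by rewrite /acc le_min ler01 divr_ge0// ltW. Qed.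

Lemma acc_le1 x y : acc x y <= 1.
Proof. by rewrite /acc ge_min lexx. Qed.

Lemma normr_acc x y : `|acc x y| <= 1.
Proof. by rewrite ger0_norm ?acc_ge0 ?acc_le1. Qed.

Lemma normr_rej x y : `|1 - acc x y| <= 1.
Proof. by rewrite ger0_norm ?subr_ge0 ?acc_le1// gerBl acc_ge0. Qed.

Lemma mul_acc x y : w x * acc x y = Num.min (w x) (w y).
Proof.
by rewrite /acc minr_pMr ?(ltW (w_gt0 x))// mulr1 mulrCA divff ?mulr1// gt_eqF.
Qed.

Lemma acc_ge x y : w y / B <= acc x y.
Proof.
rewrite /acc le_min ler_pdivrMr// mul1r wB/= ler_wpM2l// ?(ltW (w_gt0 y))//.
by rewrite lef_pV2 ?posrE.
Qed.

Lemma measurable_acc2 : measurable_fun setT (fun p : T * T => acc p.1 p.2).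
Proof.
apply: measurable_minr; first exact: measurable_cst.
apply: measurable_funM; first by apply: measurableT_comp.
by apply: measurable_funV => //; apply: measurableT_comp.
Qed.

Lemma measurable_acc x : measurable_fun setT (acc x).
Proof.
by rewrite /acc; apply: measurable_minr => //; exact: measurable_funM.
Qed.

Lemma intgw f : intg Q f -> intg Q (fun x => w x * f x).
Proof.
by apply: (intg_mulB B_gt0) => // x; rewrite wB ltW.
Qed.

Lemma intg_w : intg Q w.
Proof.
by have := intgw (intg_cst Q 1); under eq_fun do rewrite mulr1.
Qed.

Lemma intg_move g x : intg Q g ->
  intg Q (fun y => acc x y * g y + (1 - acc x y) * g x).
Proof.
move=> jg; apply: intgD.
  by apply: intg_bounded => //; [exact: measurable_acc|exact: normr_acc].
apply: intg_bounded; [|exact: normr_rej|exact: intg_cst].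
by apply: measurable_funB => //; exact: measurable_acc.
Qed.

Let intg2 f g : intg Q f -> intg Q g -> intg Q (fun x => f x * g x) ->
  intg (Q \x Q)%E (fun p => f p.1 * (acc p.1 p.2 * g p.2 + (1 - acc p.1 p.2) * g p.1)).
Proof.
move=> jf jg jfg.
rewrite (_ : (fun p => _) = fun p : T * T => acc p.1 p.2 * (f p.1 * g p.2) +
   (1 - acc p.1 p.2) * (f p.1 * g p.1 * 1)); last first.
  by apply/funext => p; ring.
have ma := measurable_acc2.
apply: intgD; apply: intg_bounded => //.
- by move=> p; exact: normr_acc.
- exact: intg_prodM.
- exact: measurable_funB.
- by move=> p; exact: normr_rej.
- exact: (intg_prodM jfg (intg_cst Q 1)).
Qed.

(** The accepted part only needs [f] and [g] separately, as they sit at independent points; the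
    rejected part has both at [x], hence the hypothesis on the product. *)
Lemma intg_metropolis f g : intg Q f -> intg Q g -> intg Q (fun x => f x * g x) ->
  intg Q (fun x => f x * metropolis g x).
Proof.
move=> jf jg jfg.
have [+ _] := Rintegral12 (intg2 jf jg jfg) (fun x => intgZ (f x) (intg_move x jg)).
by apply: eq_integrable => // x _ /=; rewrite RintegralZl//; exact: intg_move.
Qed.

Lemma measurable_metropolis g : intg Q g -> measurable_fun setT (metropolis g).
Proof.
move=> jg; apply: (@intg_mfun _ _ _ Q).
have E h : (fun x : T => 1 * h x) = h :> (T -> R).
  by apply/funext => x; rewrite mul1r.
by have := @intg_metropolis (fun=> 1) g (intg_cst Q 1) jg; rewrite !E; exact.
Qed.

(** The crude bound [|P g x| <= \int |g| dQ + |g x|] is enough, since constants are square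
    integrable for [Q]. *)
Lemma sqint_metropolis g : sqint Q g -> sqint Q (metropolis g).
Proof.
move=> sg; have jg := sqint_intg sg.
have sc : sqint Q (fun x => \int[Q]_y `|g y| + `|g x|).
  by apply: sqintD; [exact: sqint_cst|exact: sqint_norm].
apply: sqint_le sc _; first exact: measurable_metropolis.
move=> x; rewrite [leRHS]ger0_norm; last by rewrite addr_ge0// Rintegral_ge0.
apply: (le_trans (le_normr_Rintegral _ (intg_move x jg))) => //.
rewrite -[X in _ + X]mulr1 -[X in _ + _ * X]fineQT.
rewrite -Rintegral_cst// -RintegralD//; last first.
- exact: intg_cst.
- exact: integrable_norm.
apply: le_Rintegral => //.
- by apply: integrable_norm => //; exact: intg_move.
- by apply: intgD; [exact: integrable_norm|exact: intg_cst].
- move=> y _; rewrite (le_trans (ler_normD _ _))// lerD// normrM ler_piMl//.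
    exact: normr_acc.
  exact: normr_rej.
Qed.

Definition wmin x y := Num.min (w x) (w y).

Definition wmin_conv g x := \int[Q]_y (wmin x y * g y).

Let wmin_ge0 x y : 0 <= wmin x y.
Proof. by rewrite le_min !ltW. Qed.

Let wminC x y : wmin x y = wmin y x.
Proof. exact: minC. Qed.

Let measurable_wmin2 : measurable_fun setT (fun p : T * T => wmin p.1 p.2).
Proof. by apply: measurable_minr; apply: measurableT_comp. Qed.

Let wmin_leB x y : wmin x y <= B.
Proof. by rewrite ge_min wB. Qed.

Let intg_wmin g x : intg Q g -> intg Q (fun y => wmin x y * g y).
Proof.
move=> jg; apply: (intg_mulB B_gt0) => //; last by move=> y; rewrite wmin_ge0 wmin_leB.
exact: measurable_minr.
Qed.

Let intg2_wmin f g : intg Q f -> intg Q g ->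
  intg (Q \x Q)%E (fun p => wmin p.1 p.2 * (f p.1 * g p.2)).
Proof.
move=> jf jg; apply: (intg_mulB B_gt0) => //; last exact: intg_prodM.
by move=> p; rewrite wmin_ge0 wmin_leB.
Qed.

Lemma intg_mul_wmin_conv f g : intg Q f -> intg Q g ->
  intg Q (fun x => f x * wmin_conv g x).
Proof.
move=> jf jg; have [] := Rintegral12 (intg2_wmin jf jg).
  move=> x; have := intgZ (f x) (intg_wmin x jg).
  by apply: eq_integrable => // y _ /=; rewrite mulrCA.
move=> + _; apply: eq_integrable => // x _ /=.
rewrite -RintegralZl//; last exact: intg_wmin.
by congr EFin; apply: eq_Rintegral => y _ /=; ring.
Qed.

Lemma Rintegral_wmin_convC f g : intg Q f -> intg Q g ->
  \int[Q]_x (f x * wmin_conv g x) = \int[Q]_x (g x * wmin_conv f x).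
Proof.
move=> jf jg.
have := Rintegral_swap (intg2_wmin jf jg) _ _ => swap.
transitivity (\int[Q]_x \int[Q]_y (wmin x y * (f x * g y))).
  apply: eq_Rintegral => x _; rewrite -RintegralZl//; last exact: intg_wmin.
  by apply: eq_Rintegral => y _ /=; ring.
rewrite swap/=.
- apply: eq_Rintegral => x _; rewrite -RintegralZl//; last exact: intg_wmin.
  by apply: eq_Rintegral => y _ /=; rewrite wminC; ring.
- move=> x; have := intgZ (f x) (intg_wmin x jg).
  by apply: eq_integrable => // y _ /=; rewrite mulrCA.
- move=> y; have := intgZ (g y) (intg_wmin y jf).
  by apply: eq_integrable => // x _ /=; rewrite wminC; congr EFin; ring.
Qed.

(** [M x] is [w x] times the probability of accepting a move from [x], so [w - M] is the weighted
    rejection probability. *)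
Let M := wmin_conv (fun=> 1).

Let intg_conv g : intg Q g -> intg Q (wmin_conv g).
Proof.
move=> jg; have := intg_mul_wmin_conv (intg_cst Q 1) jg.
by apply: eq_integrable => // x _; rewrite /= mul1r.
Qed.

Lemma wmin_conv1_le x : wmin_conv (fun=> 1) x <= w x.
Proof.
have i1 := intg_wmin x (intg_cst Q 1).
rewrite -[leRHS]mulr1 -[X in _ * X]fineQT.
rewrite -Rintegral_cst//; apply: le_Rintegral => //; first exact: intg_cst.
by move=> y _; rewrite mulr1 ge_min lexx.
Qed.

Let M_rej x : 0 <= w x - M x <= B.
Proof.
rewrite subr_ge0 wmin_conv1_le/= lerBlDr (le_trans (wB x))// lerDl.
by rewrite Rintegral_ge0// => y _; rewrite mulr1.
Qed.

Let intg_M_rej g : intg Q g -> intg Q (fun x => (w x - M x) * g x).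
Proof.
apply: (intg_mulB B_gt0) => //; apply: measurable_funB => //.
by apply: intg_mfun; apply: intg_conv; exact: intg_cst.
Qed.

(** After weighting by [w], the operator is a symmetric kernel plus multiplication by the
    nonnegative function [w - M]. Invariance, reversibility and positivity are all read off these
    two pieces. *)
Lemma mul_metropolis g x : intg Q g ->
  w x * metropolis g x = wmin_conv g x + (w x - M x) * g x.
Proof.
move=> jg; have i1 := intg_wmin x (intg_cst Q 1).
have ig := intg_wmin x jg.
rewrite /metropolis -RintegralZl//; last exact: intg_move.
transitivity (\int[Q]_y (wmin x y * g y + (w x * g x - g x * (wmin x y * 1)))).
  by apply: eq_Rintegral => y _; rewrite -[wmin x y]mul_acc; ring.
rewrite RintegralD//; last by apply: intgB; [exact: intg_cst|exact: intgZ].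
rewrite RintegralB//; [|exact: intg_cst|exact: intgZ].
rewrite Rintegral_cst// RintegralZl//.
rewrite fineQT.
by rewrite -/(wmin_conv g x) -/(wmin_conv (fun=> 1) x) -/(M x); ring.
Qed.

(** Invariance of [w . Q]: by symmetry of the kernel, the integral of [wmin_conv g] equals that of
    [M * g], which is exactly what the rejection part lacks. *)
Lemma Rintegral_metropolis g : intg Q g ->
  \int[Q]_x (w x * metropolis g x) = \int[Q]_x (w x * g x).
Proof.
move=> jg; have jc := intg_conv jg; have c1 := intg_cst Q 1.
under eq_Rintegral do rewrite mul_metropolis//.
rewrite RintegralD//; last exact: intg_M_rej.
under [X in _ + X]eq_Rintegral do rewrite mulrBl.
rewrite RintegralB//; last 2 first.
- exact: intgw.
- have := intg_mul_wmin_conv jg c1.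
  by apply: eq_integrable => // x _ /=; rewrite mulrC.
have := Rintegral_wmin_convC c1 jg.
under eq_Rintegral do rewrite mul1r.
move=> ->; under [X in _ - X]eq_Rintegral do rewrite mulrC.
by rewrite addrCA subrr addr0.
Qed.

Lemma Rintegral_mul_metropolis f g : sqint Q f -> sqint Q g ->
  \int[Q]_x (w x * (f x * metropolis g x)) =
  \int[Q]_x (f x * wmin_conv g x) + \int[Q]_x ((w x - M x) * (f x * g x)).
Proof.
move=> sf sg; have jf := sqint_intg sf; have jg := sqint_intg sg.
rewrite -RintegralD//; last 2 first.
- exact: intg_mul_wmin_conv.
- by apply: intg_M_rej; exact: sqintM.
by apply: eq_Rintegral => x _; rewrite mulrCA mul_metropolis//; ring.
Qed.

Lemma metropolisC f g : sqint Q f -> sqint Q g ->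
  \int[Q]_x (w x * (f x * metropolis g x)) =
  \int[Q]_x (w x * (g x * metropolis f x)).
Proof.
move=> sf sg; rewrite !Rintegral_mul_metropolis//.
rewrite Rintegral_wmin_convC; [|exact: sqint_intg..].
by congr (_ + _); apply: eq_Rintegral => x _; rewrite (mulrC (f x)).
Qed.

(* [a(x, y) - w(y) / B >= 0] has total mass [1 - 1 / B] once the rejection mass
   is added; the inequality is Jensen's for this sub-probability, written as the
   nonnegativity of its second moment about [c]. *)
Lemma metropolis_contraction g : sqint Q g -> \int[Q]_x (w x * g x) = 0 ->
  \int[Q]_x (w x * metropolis g x ^+ 2) <=
  (1 - B^-1) ^+ 2 * \int[Q]_x (w x * g x ^+ 2).
Proof.
move=> sg g0; have jg := sqint_intg sg; have [mg jg2] := sg.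
have jw := intg_w.
set rho := 1 - B^-1; have rho0 : 0 < rho by rewrite subr_gt0 invf_lt1.
set pg2 := \int[Q]_x (w x * g x ^+ 2).
have pt x : metropolis g x ^+ 2 <=
    rho * (metropolis (fun x => g x ^+ 2) x - B^-1 * pg2).
  (* The mean of [g] under what remains of the kernel: since [g] is centred, removing [w y / B]
     leaves the first moment [P g x] unchanged and the mass equal to [rho]. *)
  set c := metropolis g x / rho.
  have jm := intg_move x jg; have jm2 := intg_move x jg2.
  have : 0 <= \int[Q]_y ((acc x y - w y / B) * (g y - c) ^+ 2 +
                         (1 - acc x y) * (g x - c) ^+ 2).
    apply: Rintegral_ge0 => y _; rewrite addr_ge0// mulr_ge0 ?sqr_ge0//.
      by rewrite subr_ge0 acc_ge.
    by rewrite subr_ge0 acc_le1.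
  have jw2 := intgw jg2; have jw1 := intgw jg.
  rewrite (_ : \int[Q]_y _ = \int[Q]_y (
      (acc x y * g y ^+ 2 + (1 - acc x y) * g x ^+ 2) +
      ((- B^-1) * (w y * g y ^+ 2) +
      ((- (2 * c)) * (acc x y * g y + (1 - acc x y) * g x) +
      ((2 * c / B) * (w y * g y) +
      (c ^+ 2 + (- (c ^+ 2 / B)) * w y))))) ); last first.
    by apply: eq_Rintegral => y _; ring.
  have j5 : intg Q (fun y => c ^+ 2 + (- (c ^+ 2 / B)) * w y).
    by apply: intgD; [exact: intg_cst|exact: intgZ].
  have j4 : intg Q (fun y => (2 * c / B) * (w y * g y) +
      (c ^+ 2 + (- (c ^+ 2 / B)) * w y)) by apply: intgD => //; exact: intgZ.
  have j3 : intg Q (fun y => (- (2 * c)) * (acc x y * g y + (1 - acc x y) * g x) +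
     ((2 * c / B) * (w y * g y) + (c ^+ 2 + (- (c ^+ 2 / B)) * w y))).
    by apply: intgD => //; exact: intgZ.
  rewrite RintegralD//; last by apply: intgD => //; exact: intgZ.
  rewrite -/(metropolis (fun x => g x ^+ 2) x).
  rewrite RintegralD//; last exact: intgZ.
  rewrite RintegralD//; last exact: intgZ.
  rewrite RintegralD//; last exact: intgZ.
  rewrite RintegralD//; [|exact: intg_cst|exact: intgZ].
  rewrite Rintegral_cst//; do 4 rewrite RintegralZl//.
  rewrite w1 g0.
  rewrite fineQT.
  rewrite -/(metropolis g x) -/(metropolis (fun x => g x ^+ 2) x) -/pg2.
  set a := metropolis (fun x => g x ^+ 2) x.
  have -> : a + (- B^-1 * pg2 + (- (2 * c) * metropolis g x +
     (2 * c / B * 0 + (c ^+ 2 * 1 + - (c ^+ 2 / B) * 1)))) =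
     (a - B^-1 * pg2) - 2 * c * metropolis g x + c ^+ 2 * rho.
    by rewrite /rho; ring.
  set e := a - _; rewrite (_ : _ + _ = e - metropolis g x ^+ 2 / rho); last first.
    by rewrite /c; field; rewrite gt_eqF.
  by rewrite subr_ge0 ler_pdivrMr// mulrC.
have sm := sqint_metropolis sg.
apply: (@le_trans _ _ (\int[Q]_x (rho * (w x * metropolis (fun x => g x ^+ 2) x
   - B^-1 * pg2 * w x)))).
  apply: le_Rintegral => //.
  - by apply: intgw; case: sm.
  - apply: intgZ; apply: intgB; last exact: intgZ.
    apply: intgw; have := intg_metropolis (intg_cst Q 1) jg2.
    have E h : (fun x : T => 1 * h x) = h :> (T -> R).
      by apply/funext => x; rewrite mul1r.
    by rewrite !E; exact.
  - move=> x _; rewrite [leRHS](_ : _ = w x * (rho *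
       (metropolis (fun x => g x ^+ 2) x - B^-1 * pg2))); last by ring.
    by rewrite ler_wpM2l// ltW.
have jmg2 : intg Q (fun x => w x * metropolis (fun x => g x ^+ 2) x).
  apply: intgw; have := intg_metropolis (intg_cst Q 1) jg2.
  have E h : (fun x : T => 1 * h x) = h :> (T -> R).
    by apply/funext => x; rewrite mul1r.
  by rewrite !E; exact.
rewrite RintegralZl//; last by apply: intgB => //; exact: intgZ.
rewrite RintegralB//; last exact: intgZ.
(* Invariance turns the integral of [w * P (g^2)] into [pg2], so the total factor is
   [rho * (1 - 1 / B) = rho^2]. *)
rewrite RintegralZl// w1 Rintegral_metropolis// -/pg2.
by rewrite le_eqVlt; apply/orP; left; apply/eqP; rewrite /rho; ring.
Qed.

End metropolis_operator.

(** * Positivity of the Metropolis operator *)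

Section positivity.
Context d (T : measurableType d) (R : realType).
Variables (Q : probability T R) (w : T -> R) (B : R).
Hypotheses (mw : measurable_fun setT w) (w_gt0 : forall x, 0 < w x)
  (wB : forall x, w x <= B) (w1 : \int[Q]_x w x = 1) (B1 : 1 < B).
Implicit Types f g : T -> R.

Local Notation leb := (@lebesgue_measure R).

Let B_gt0 : 0 < B. Proof. exact: lt_trans B1. Qed.

Let u x (t : measurableTypeR R) : R := \1_`[0, w x[ t.

Let u2 x y : \int[leb]_t (u x t * u y t) = wmin w x y.
Proof.
transitivity (\int[leb]_t (\1_`[0, wmin w x y[ t : R)).
  apply: eq_Rintegral => t _; rewrite /u !indicE -natrM mulnb; congr (_ : bool)%:R.
  by rewrite !mem_setE !in_itv/= /wmin lt_min; case: (0 <= t).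
rewrite /Rintegral integral_indic// setIT.
rewrite [X in fine X](_ : _ = (wmin w x y)%:E)//.
transitivity (lebesgue_measure ([set` `[0, wmin w x y[] : set R)) => //.
by rewrite lebesgue_measure_itv/= lte_fin lt_min !w_gt0/= oppr0 addr0.
Qed.

(** As a function of the pair, [u] is the indicator of the region between [0] and the graph of
    [w]. *)
Let mu2 : measurable_fun setT (fun p : T * measurableTypeR R => u p.1 p.2).
Proof.
pose E := ([set: T * measurableTypeR R] `&` [set p | ((p.2)%:E < (w p.1)%:E)%E])
  `&` (snd @^-1` `[0, +oo[%classic).
have mE : measurable E.
  apply: measurableI.
    apply: measurable_lte => //; apply/measurable_EFinP => //.
    by apply: measurableT_comp.
  by rewrite -[X in measurable X]setTI; exact: measurable_snd.
rewrite (_ : (fun p => _) = \1_E); first exact: measurable_indic.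
apply/funext => -[x t]; rewrite /u !indicE; congr (_ : bool)%:R.
rewrite mem_setE in_itv/=; apply/idP/idP => [/andP[t0 tw]|/set_mem].
  by apply/mem_set; rewrite /E/= in_itv/= t0 lte_fin tw.
by rewrite /E/= in_itv/= andbT lte_fin => -[[_ ->] ->].
Qed.

(* Layer cake: [min(w x, w y) = \int u_x u_y], so the quadratic form is the
   integral over [t] of [(\int u_x(t) g(x) dQ(x))^2]. *)
Lemma wmin_conv_psd g : intg Q g -> 0 <= \int[Q]_x (g x * wmin_conv Q w g x).
Proof.
move=> jg.
pose G t := \int[Q]_y (u y t * g y).
have u0 x t : 0 <= u x t by exact: fun_ge0.
have ju x : intg leb (u x).
  by apply: integrable_indic_itv.
(* As [w <= B], every [u x] vanishes outside [[0, B[]. This gives the integrable domination required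
   by Fubini, the line having infinite measure. *)
pose e (t : measurableTypeR R) : R := \1_`[0, B[ t.
have je : intg leb e by apply: integrable_indic_itv.
have ue x t : u x t <= e t.
  rewrite /u /e !indicE ler_nat !mem_setE !in_itv/=.
  by case: (0 <= t) => //=; case: ltP => // /lt_le_trans ->.
have mu' x : measurable_fun setT (u x) by exact: measurable_indic.
have u_le1 x t : `|u x t| <= 1 by rewrite ger0_norm// /u indicE lern1 leq_b1.
have mug t : measurable_fun setT (fun x => u x t).
  exact: (measurableT_comp mu2 (pair2_measurable t)).
have Gle t : `|G t| <= \int[Q]_y `|g y|.
  apply: (le_trans (le_normr_Rintegral _ _)) => //.
    exact: intg_bounded.
  apply: le_Rintegral => //.
  - by apply: integrable_norm => //; exact: intg_bounded.
  - exact: integrable_norm.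
  - by move=> x _; rewrite normrM ler_piMl.
have mG : measurable_fun setT G.
  have ji : intg (Q \x leb)%E (fun p => u p.1 p.2 * g p.1).
    apply: (le_intg _ _ (intg_prodM (integrable_norm jg) je)) => /=.
      by apply: measurable_funM => //; apply: measurableT_comp => //; exact: (intg_mfun jg).
    move=> p; rewrite normrM mulrC ler_wpM2l// ger0_norm//.
  have jug t : intg Q (fun x => u x t * g x) by exact: intg_bounded.
  by have [] := Rintegral21 ji jug.
have jG x : intg leb (fun t => u x t * G t).
  apply: (le_intg _ _ (intgZ (\int[Q]_y `|g y|) (ju x))).
    exact: measurable_funM.
  by move=> t; rewrite normrM mulrC (ger0_norm (u0 x t)) ler_wpM2r.
(* A first use of Fubini, with [x] fixed; a second one, on [u x t * g x * G t], will make the inner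
   integral [G t ^+ 2]. *)
have convE x : wmin_conv Q w g x = \int[leb]_t (u x t * G t).
  pose phi (p : T * measurableTypeR R) := u x p.2 * (u p.1 p.2 * g p.1).
  have jphi : intg (Q \x leb)%E phi.
    apply: (le_intg _ _ (intg_prodM (integrable_norm jg) (ju x))) => /=.
      apply: measurable_funM; first by apply: measurableT_comp.
      by apply: measurable_funM => //; apply: measurableT_comp => //; exact: (intg_mfun jg).
    move=> p; rewrite /phi !normrM mulrC (ger0_norm (u0 x _)) ler_wpM2r//.
    by rewrite ler_piMl.
  transitivity (\int[Q]_y \int[leb]_t phi (y, t)).
    apply: eq_Rintegral => y _; rewrite -u2 -RintegralZr//.
      by apply: eq_Rintegral => t _; rewrite /phi/= mulrA.
    apply: (intg_bounded (mu' x) (u_le1 x) (ju y)).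
  rewrite (Rintegral_swap jphi).
  - apply: eq_Rintegral => t _; rewrite /phi/= RintegralZl//.
    exact: intg_bounded.
  - move=> y; rewrite /phi/=.
    have := intgZ (g y) (intg_bounded (mu' x) (u_le1 x) (ju y)).
    by apply: eq_integrable => // t _ /=; congr EFin; ring.
  - by move=> t; rewrite /phi/=; apply: intgZ; exact: intg_bounded.
pose phi (p : T * measurableTypeR R) := u p.1 p.2 * g p.1 * G p.2.
have jphi : intg (Q \x leb)%E phi.
  apply: (le_intg _ _ (intg_prodM (integrable_norm jg)
     (intgZ (\int[Q]_y `|g y|) je))) => /=.
    apply: measurable_funM; last by apply: measurableT_comp.
    by apply: measurable_funM => //; apply: measurableT_comp => //; exact: (intg_mfun jg).
  move=> p; rewrite /phi !normrM -mulrA mulrCA ler_wpM2l// mulrC.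
  by rewrite ler_pM// ger0_norm.
rewrite (_ : \int[Q]_x _ = \int[Q]_x \int[leb]_t phi (x, t)); last first.
  apply: eq_Rintegral => x _; rewrite convE -RintegralZl.
  - by apply: eq_Rintegral => t _; rewrite /phi/=; ring.
  - by [].
  exact: jG.
rewrite (Rintegral_swap jphi).
- apply: Rintegral_ge0 => t _; rewrite /phi/= RintegralZr//; first exact: sqr_ge0.
  exact: intg_bounded.
- move=> x; rewrite /phi/=.
  have := intgZ (g x) (jG x).
  by apply: eq_integrable => // t _ /=; congr EFin; ring.
- move=> t; rewrite /phi/=; have := intgZ (G t) (intg_bounded (mug t) (u_le1^~ t) jg).
  by apply: eq_integrable => // x _ /=; congr EFin; ring.
Qed.

Lemma metropolis_psd g : sqint Q g ->
  0 <= \int[Q]_x (w x * (g x * metropolis Q w g x)).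
Proof.
move=> sg; rewrite (Rintegral_mul_metropolis mw w_gt0 wB B1)//.
rewrite addr_ge0// ?wmin_conv_psd//; first exact: sqint_intg.
apply: Rintegral_ge0 => x _; rewrite mulr_ge0 ?sqr_ge0//.
by rewrite subr_ge0; exact: (wmin_conv1_le Q mw w_gt0 wB B1).
Qed.

(** Induction in steps of two: reversibility moves one factor across, so the form of [P^(k+2)] at
    [g] is the form of [P^k] at [P g]. The base cases are [P^0] and [P]. *)
Lemma iter_metropolis_psd k g : sqint Q g ->
  0 <= \int[Q]_x (w x * (g x * iter k (metropolis Q w) g x)).
Proof.
elim/ltn_ind: k g => -[|[|k]] ih g sg /=.
- by apply: Rintegral_ge0 => x _; rewrite mulr_ge0 ?sqr_ge0// ltW.
- exact: metropolis_psd.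
- have sP h : sqint Q h -> sqint Q (metropolis Q w h).
    exact: (sqint_metropolis mw w_gt0).
  have sk : sqint Q (iter k (metropolis Q w) (metropolis Q w g)).
    by elim: {ih} k => [|k ihk] /=; apply: sP.
  rewrite -iterS iterSr (metropolisC mw w_gt0 wB B1)//.
  under eq_Rintegral do rewrite [X in w _ * X]mulrC.
  by apply: ih => //; exact: sP.
Qed.

End positivity.

(** * Integrals against laws of random variables *)

Section transfer.
Context d (T : measurableType d) (R : realType).
Implicit Types (m : {measure set T -> \bar R}) (f : T -> R).

Lemma intg_eq_measure m1 m2 f : (forall A, measurable A -> m1 A = m2 A) ->
  intg m1 f -> intg m2 f.
Proof.
move=> m12 /integrableP[mf foo]; apply/integrableP; split => //.
rewrite (_ : (\int[m2]_x _ = \int[m1]_x `|(EFin \o f) x|)%E)//.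
by apply: eq_measure_integral => A mA _; rewrite m12.
Qed.

Lemma Rintegral_eq_measure m1 m2 f : (forall A, measurable A -> m1 A = m2 A) ->
  \int[m1]_x f x = \int[m2]_x f x.
Proof.
by move=> m12; congr fine; apply: eq_measure_integral => A mA _; rewrite m12.
Qed.

End transfer.

Section distributions.
Context d d' (Om : measurableType d) (S : measurableType d') (R : realType).
Variable P : probability Om R.
Implicit Types (V : {mfun Om >-> S}) (f : S -> R).

Lemma intg_distribution V f : measurable_fun setT f ->
  intg (distribution P V) f <-> intg P (fun x => f (V x)).
Proof.
move=> mf.
have E : (\int[distribution P V]_x `|(f x)%:E| = \int[P]_x `|(f (V x))%:E|)%E.
  rewrite ge0_integral_distribution//.
  by apply: measurableT_comp => //; exact/measurable_EFinP.
split => /integrableP[_ foo]; apply/integrableP; split => //=.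
- by apply/measurable_EFinP; exact: measurableT_comp.
- by rewrite -E.
- exact/measurable_EFinP.
- by rewrite E.
Qed.

Lemma Rintegral_distribution V f : measurable_fun setT f ->
  intg P (fun x => f (V x)) ->
  \int[distribution P V]_x f x = \int[P]_x f (V x).
Proof.
by move=> mf jf; congr fine; apply: integral_distribution => //; exact/measurable_EFinP.
Qed.

End distributions.

Section pair_mfun.
Context d d1 d2 (Om : measurableType d) (S1 : measurableType d1) (S2 : measurableType d2).
Variables (V1 : {mfun Om >-> S1}) (V2 : {mfun Om >-> S2}).

Definition pair_mfun x : S1 * S2 := (V1 x, V2 x).

Let measurable_pair_mfun : measurable_fun setT pair_mfun.
Proof. exact: measurable_fun_pair. Qed.

HB.instance Definition _ := isMeasurableFun.Build _ _ _ _ pair_mfun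
  measurable_pair_mfun.

End pair_mfun.

Section density_law.
Context d d' (Om : measurableType d) (T : measurableType d') (R : realType).
Variables (P : probability Om R) (Q : probability T R) (w : T -> R) (B : R).
Hypotheses (mw : measurable_fun setT w) (w_ge0 : forall x, 0 <= w x)
  (wB : forall x, w x <= B) (B0 : 0 < B).
Variable X : {mfun Om >-> T}.
Implicit Types f : T -> R.
Hypothesis lawX : forall A, measurable A ->
  (P (X @^-1` A) = \int[Q]_(x in A) (w x)%:E)%E.

Lemma ge0_integral_law f : measurable_fun setT f -> (forall x, 0 <= f x) ->
  (\int[P]_x (f (X x))%:E = \int[Q]_x (f x * w x)%:E)%E.
Proof.
move=> mf f0; rewrite -(integral_density (nu := distribution P X) mw)//.
by rewrite ge0_integral_distribution//; exact/measurable_EFinP.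
Qed.

Lemma intg_law f : intg Q f -> intg P (fun x => f (X x)).
Proof.
move=> jf; have mf := intg_mfun jf; apply/integrableP; split => /=.
  by apply/measurable_EFinP; exact: measurableT_comp.
rewrite (ge0_integral_law (f := fun x => `|f x|))//; last first.
  exact: measurableT_comp.
have : intg Q (fun x => w x * `|f x|).
  by apply: (intg_mulB B0 mw) => [x|]; [rewrite w_ge0 wB|exact: integrable_norm].
move=> /integrableP[_]; congr (_ < _)%E; apply: eq_integral => x _ /=.
by rewrite ger0_norm ?mulr_ge0// mulrC.
Qed.

Let RintegralX_ge0 f : intg Q f -> (forall x, 0 <= f x) ->
  \int[P]_x f (X x) = \int[Q]_x (w x * f x).
Proof.
move=> jf f0; have mf := intg_mfun jf.
rewrite /Rintegral ge0_integral_law//; congr fine.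
by apply: eq_integral => x _; rewrite mulrC.
Qed.

Lemma Rintegral_law f : intg Q f -> \int[P]_x f (X x) = \int[Q]_x (w x * f x).
Proof.
move=> jf; have jn : intg Q (fun x => `|f x|) by exact: integrable_norm.
have jw g : intg Q g -> intg Q (fun x => w x * g x).
  by apply: (intg_mulB B0 mw) => x; rewrite w_ge0 wB.
have jD := intgD jf jn.
have fn x : 0 <= f x + `|f x| by rewrite -lerBlDl sub0r -normrN ler_norm.
rewrite [LHS](_ : _ = \int[P]_x ((f (X x) + `|f (X x)|) - `|f (X x)|)); last first.
  by apply: eq_Rintegral => x _; rewrite addrK.
rewrite RintegralB//; [|exact: (intg_law jD)|exact: (intg_law jn)].
rewrite (RintegralX_ge0 jD)// (RintegralX_ge0 jn)// -RintegralB//.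
- by apply: eq_Rintegral => x _; rewrite -mulrBr addrK.
- exact: jw.
- exact: jw.
Qed.

Lemma sqint_law f : sqint Q f -> sqint P (fun x => f (X x)).
Proof.
move=> [mf f2]; split; first exact: measurableT_comp.
exact: (intg_law f2).
Qed.

End density_law.

(* Every one-step expectation of the chain has the form
   [E[c1 * f(Z1) + c2 * f(Z2)]]. *)
Section two_point.
Context d d' (Om : measurableType d) (T : measurableType d') (R : realType).
Variable P : {measure set Om -> \bar R}.
Implicit Types (c : Om -> R) (Z : Om -> T) (f g : T -> R).

Definition two_point c1 c2 Z1 Z2 f o : R := c1 o * f (Z1 o) + c2 o * f (Z2 o).

Definition two_point_ok c1 c2 Z1 Z2 :=
  [/\ measurable_fun setT c1 /\ (forall o, 0 <= c1 o),
      measurable_fun setT c2 /\ (forall o, 0 <= c2 o),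
      measurable_fun setT Z1 & measurable_fun setT Z2].

Lemma measurable_two_point c1 c2 Z1 Z2 f : two_point_ok c1 c2 Z1 Z2 ->
  measurable_fun setT f -> measurable_fun setT (two_point c1 c2 Z1 Z2 f).
Proof.
move=> [[mc1 _] [mc2 _] mZ1 mZ2] mf.
by apply: measurable_funD; apply: measurable_funM => //; exact: measurableT_comp.
Qed.

Lemma two_point_ge0 c1 c2 Z1 Z2 f o : two_point_ok c1 c2 Z1 Z2 ->
  (forall x, 0 <= f x) -> 0 <= two_point c1 c2 Z1 Z2 f o.
Proof. by move=> [[_ c1_ge0] [_ c2_ge0] _ _] f0; rewrite addr_ge0// mulr_ge0. Qed.

(** For fixed nonnegative weights both sides are additive, homogeneous and continuous along
    increasing sequences in [f], so agreement on indicators propagates. *)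
Lemma eq_integral_two_point c1 c2 Z1 Z2 e1 e2 W1 W2 :
  two_point_ok c1 c2 Z1 Z2 -> two_point_ok e1 e2 W1 W2 ->
  (forall A, measurable A -> \int[P]_o (two_point c1 c2 Z1 Z2 \1_A o)%:E =
                             \int[P]_o (two_point e1 e2 W1 W2 \1_A o)%:E)%E ->
  forall f, measurable_fun setT f -> (forall x, 0 <= f x) ->
  (\int[P]_o (two_point c1 c2 Z1 Z2 f o)%:E =
   \int[P]_o (two_point e1 e2 W1 W2 f o)%:E)%E.
Proof.
move=> okc oke agree.
have Z_ a1 a2 A1 A2 k f : two_point_ok a1 a2 A1 A2 -> 0 <= k ->
    measurable_fun setT f -> (forall x, 0 <= f x) ->
    (\int[P]_o (two_point a1 a2 A1 A2 (fun x => k * f x) o)%:E =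
     k%:E * \int[P]_o (two_point a1 a2 A1 A2 f o)%:E)%E.
  move=> ok k0 mf f0; rewrite -ge0_integralZl_EFin//.
  - by apply: eq_integral => o _; rewrite -EFinM /two_point; congr EFin; ring.
  - by move=> o _; rewrite lee_fin two_point_ge0.
  - by apply/measurable_EFinP; exact: measurable_two_point.
have D_ a1 a2 A1 A2 f g : two_point_ok a1 a2 A1 A2 ->
    measurable_fun setT f -> (forall x, 0 <= f x) ->
    measurable_fun setT g -> (forall x, 0 <= g x) ->
    (\int[P]_o (two_point a1 a2 A1 A2 (fun x => f x + g x) o)%:E =
     \int[P]_o (two_point a1 a2 A1 A2 f o)%:E +
     \int[P]_o (two_point a1 a2 A1 A2 g o)%:E)%E.
  move=> ok mf f0 mg g0; rewrite -ge0_integralD//.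
  - by apply: eq_integral => o _; rewrite -EFinD /two_point; congr EFin; ring.
  - by move=> o _; rewrite lee_fin two_point_ge0.
  - by apply/measurable_EFinP; exact: measurable_two_point.
  - by move=> o _; rewrite lee_fin two_point_ge0.
  - by apply/measurable_EFinP; exact: measurable_two_point.
have L_ a1 a2 A1 A2 (h : nat -> T -> R) f : two_point_ok a1 a2 A1 A2 ->
    (forall n, measurable_fun setT (h n)) -> (forall n x, 0 <= h n x) ->
    (forall x, {homo h^~ x : m n / (m <= n)%N >-> m <= n}) ->
    (forall x, h n x @[n --> \oo] --> f x) ->
    (\int[P]_o (two_point a1 a2 A1 A2 (h n) o)%:E @[n --> \oo] -->
     \int[P]_o (two_point a1 a2 A1 A2 f o)%:E)%E.
  move=> ok mh h0 hnd hf; have [[_ a1_ge0] [_ a2_ge0] _ _] := ok.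
  apply: ge0_cvg_integral_EFin.
  - by move=> n; exact: measurable_two_point.
  - by move=> n o; exact: two_point_ge0.
  - by move=> o m n mn; rewrite lerD// ler_wpM2l// hnd.
  - by move=> o; apply: cvgD; apply: cvgMl_tmp; exact: hf.
apply: (@ge0_measurable_ind _ _ _ (fun f : T -> R =>
    \int[P]_o (two_point c1 c2 Z1 Z2 f o)%:E =
    \int[P]_o (two_point e1 e2 W1 W2 f o)%:E)%E) => //.
- by move=> k f k0 mf f0 E; rewrite !Z_// E.
- by move=> f g mf f0 mg g0 Ef Eg; rewrite !D_// Ef Eg.
- move=> h f mh h0 hnd hf E.
  have c_lim := L_ _ _ _ _ _ _ okc mh h0 hnd hf.
  have e_lim := L_ _ _ _ _ _ _ oke mh h0 hnd hf.
  rewrite -(cvg_lim _ c_lim)// -(cvg_lim _ e_lim)//.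
  by congr (limn _); apply/funext => n; exact: E.
Qed.

End two_point.

(** Passing from [m] to [m + 1] terms increases the second moment of a stationary sum by [c0] plus
    twice the first [m] covariances. These increments converge, and [v] is their Cesaro mean. *)
Lemma cesaro_geometric (R : realType) (c0 rho : R) (C v : nat -> R) :
  0 < rho < 1 -> (forall k, `|C k| <= c0 * rho ^+ k) ->
  (forall n, v n = n%:R^-1 * \sum_(m < n) (c0 + 2 * \sum_(k < m) C k)) ->
  exists L, [/\ v n @[n --> \oo] --> L, L <= c0 * (1 + 2 / (1 - rho)) &
                (forall k, 0 <= C k) -> c0 <= L].
Proof.
move=> /andP[rho0 rho1] Crho vE.
have c00 : 0 <= c0.
  by have := le_trans (normr_ge0 _) (Crho 0%N); rewrite expr0 mulr1.
pose t m := c0 + 2 * series C m.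
have cC : cvgn (series C).
  apply: normed_cvg; apply: (@series_le_cvg _ _ (geometric c0 rho)).
  - by move=> n; exact: normr_ge0.
  - by move=> n; rewrite /geometric/= mulr_ge0// exprn_ge0// ltW.
  - exact: Crho.
  - by apply: is_cvg_geometric_series; rewrite ger0_norm// ltW.
have ct : t n @[n --> \oo] --> c0 + 2 * limn (series C).
  by apply: cvgD; [exact: cvg_cst|apply: cvgMl_tmp].
have sC m : series C m <= c0 / (1 - rho).
  apply: (@le_trans _ _ (\sum_(0 <= k < m) c0 * rho ^+ k)).
    by apply: ler_sum => k _; rewrite (le_trans (ler_norm _)).
  rewrite -mulr_sumr ler_wpM2l// -[leRHS]mul1r ler_pdivlMr ?subr_gt0// mulrC.
  rewrite big_mkord -opprB mulNr -subrX1 opprB gerBl.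
  by rewrite exprn_ge0// ltW.
exists (c0 + 2 * limn (series C)); split.
(* [arithmetic_mean] at [n] averages [n + 1] terms, hence the shift. *)
- rewrite -(cvg_shiftS v); have := cesaro ct; apply: cvg_trans.
  apply: near_eq_cvg; near=> n.
  rewrite /arithmetic_mean/= vE /series/= big_mkord; congr (_ * _).
  by apply: eq_bigr => m _; rewrite /t /series/= big_mkord.
- rewrite mulrDr mulr1 lerD2l mulrCA ler_pM2l//.
  by apply: limr_le => //; apply: nearW => m; exact: sC.
- move=> C0; rewrite lerDl mulr_ge0//; apply: limr_ge => //.
  by apply: nearW => m; apply: sumr_ge0 => k _.
Unshelve. all: by end_near. Qed.

(** * The stationary chain *)

Section chain.
Context d d' (Om : measurableType d) (T : measurableType d') (R : realType).
Variables (P : probability Om R) (Q : probability T R) (w : T -> R) (B : R).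
Hypotheses (mw : measurable_fun setT w) (w_gt0 : forall x, 0 < w x)
  (wB : forall x, w x <= B) (w1 : \int[Q]_x w x = 1) (B1 : 1 < B).
Variables X Y : nat -> {mfun Om >-> T}.
Implicit Types f g : T -> R.

(** The generators of [past] on an abstract state space, with the same body so that facts about
    [IM_chain] transfer by conversion. *)
Definition hist_gen n : set (set Om) :=
  [set S | exists i A, measurable A /\
    (((i <= n)%N /\ S = X i @^-1` A) \/ ((i < n)%N /\ S = Y i @^-1` A))].

Definition hist n := <<s hist_gen n >>.

Hypothesis law_X0 : forall A, measurable A ->
  (P (X 0%N @^-1` A) = \int[Q]_(x in A) (w x)%:E)%E.

Hypothesis chainP : forall n H A C, hist n H -> measurable A -> measurable C ->
  (P (H `&` (Y n @^-1` A) `&` (X n.+1 @^-1` C)) =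
   \int[P]_(o in H) \int[Q]_(y in A)
     (acc w (X n o) y * \1_C y + (1 - acc w (X n o) y) * \1_C (X n o))%:E)%E.

Let B_gt0 : 0 < B. Proof. exact: lt_trans B1. Qed.

Definition adapted d1 (S : measurableType d1) n (V : Om -> S) :=
  forall A, measurable A -> hist n (V @^-1` A).

Lemma hist_measurable n H : hist n H -> measurable H.
Proof.
apply: smallest_sub; first exact: sigma_algebra_measurable.
by move=> S [i [A [mA [[_ ->]|[_ ->]]]]]; rewrite -[X in measurable X]setTI;
  exact: measurable_funPT.
Qed.

(** Measurability for the sigma-algebra generated by [hist_gen n]; closure under pairing then comes
    from the general theory. *)
Lemma adaptedP d1 (S : measurableType d1) n (V : Om -> S) :
  adapted n V <-> measurable_fun setT (V : g_sigma_algebraType (hist_gen n) -> S).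
Proof.
split=> [aV _ A mA|mV A mA].
  by rewrite setTI; exact: aV.
by have := mV measurableT A mA; rewrite setTI.
Qed.

Lemma adapted_pair d1 d2 (S1 : measurableType d1) (S2 : measurableType d2) n
    (V1 : {mfun Om >-> S1}) (V2 : {mfun Om >-> S2}) :
  adapted n V1 -> adapted n V2 -> adapted n (pair_mfun V1 V2).
Proof.
by move=> /adaptedP m1 /adaptedP m2; apply/adaptedP; exact: measurable_fun_pair.
Qed.

Lemma adaptedX i n : (i <= n)%N -> adapted n (X i).
Proof. by move=> i_n A mA; apply: sub_sigma_algebra; exists i, A; split => //; left. Qed.

Lemma adaptedY i n : (i < n)%N -> adapted n (Y i).
Proof. by move=> i_n A mA; apply: sub_sigma_algebra; exists i, A; split => //; right. Qed.

Lemma hist_setT n : hist n setT.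
Proof. by have := adaptedX (leqnn n) measurableT; rewrite preimage_setT. Qed.

Section one_step.
Context d1 (S : measurableType d1) (n : nat) (V : {mfun Om >-> S}).
Hypothesis aV : adapted n V.

(** Independence of [Y n] from the past: when the next state is unconstrained, the acceptance and
    rejection weights add up to 1, and [chainP] factorises on rectangles. *)
Lemma law_VY E : measurable E ->
  distribution P (pair_mfun V (Y n)) E = (distribution P V \x Q)%E E.
Proof.
apply: eq_measure_rect.
  by rewrite (le_lt_trans (probability_le1 _ _))// ltry.
move=> A C mA mC.
transitivity (distribution P V A * Q C)%E; last first.
  by apply/esym; exact: product_measure1E.
have := chainP (aV mA) mC measurableT.
rewrite preimage_setT setIT => /= E1.
rewrite [LHS](_ : _ = P (V @^-1` A `&` Y n @^-1` C))// E1.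
have mVA : measurable (V @^-1` A) by apply: (hist_measurable (n := n)); exact: aV.
transitivity (\int[P]_(o in V @^-1` A) (cst (Q C) o))%E.
  apply: eq_integral => o _.
  under eq_integral do rewrite !indicT !mulr1 addrC subrK.
  by rewrite integral_cst// mul1e.
by rewrite (integral_cst P mVA) muleC.
Qed.

Lemma Rintegral_VY (phi : S * T -> R) (h : S -> R) : measurable_fun setT phi ->
  (forall v, intg Q (fun y => phi (v, y))) ->
  (forall v, \int[Q]_y `|phi (v, y)| <= h v) ->
  intg P (fun o => h (V o)) ->
  [/\ intg P (fun o => phi (V o, Y n o)),
      intg P (fun o => \int[Q]_y phi (V o, y)) &
      \int[P]_o phi (V o, Y n o) = \int[P]_o \int[Q]_y phi (V o, y)].
Proof.
move=> mphi jv phi_h jh.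
have jn v : intg Q (fun y => `|phi (v, y)|) by exact: integrable_norm.
have mnorm : measurable_fun setT (fun v : S => \int[Q]_y `|phi (v, y)|).
  by apply: (measurable_Rintegral2 (phi := fun p => `|phi p|)) => //; exact: measurableT_comp.
have jabs : intg P (fun o => \int[Q]_y `|phi (V o, y)|).
  apply: le_intg jh.
    exact: (measurableT_comp mnorm (measurable_funPT V)).
  by move=> o; rewrite ger0_norm// Rintegral_ge0.
have jprod : intg (distribution P V \x Q)%E phi.
  apply/integrable12ltyP; first exact/measurable_EFinP.
  have /(intg_distribution P V mnorm)/integrableP[_] := jabs.
  congr (_ < _)%E; apply: eq_integral => v _ /=.
  by rewrite ger0_norm ?Rintegral_ge0// (EFin_Rintegral (jn v)).
have jdist : intg (distribution P (pair_mfun V (Y n))) phi.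
  by apply: intg_eq_measure jprod => A mA; apply/esym; exact: law_VY.
have jcomp : intg P (fun o => phi (V o, Y n o)).
  by move: jdist => /(intg_distribution P (pair_mfun V (Y n)) mphi).
have [jF EF] := Rintegral12 jprod jv.
have mF : measurable_fun setT (fun v : S => \int[Q]_y phi (v, y)).
  exact: (intg_mfun jF).
have jF' : intg P (fun o => \int[Q]_y phi (V o, y)).
  by move: jF => /(intg_distribution P V mF).
split => //.
rewrite -(Rintegral_distribution mF jF') EF.
rewrite -(Rintegral_distribution (V := pair_mfun V (Y n)) mphi jcomp).
by apply: Rintegral_eq_measure => A mA; exact: law_VY.
Qed.

(** This is the conditional expectation of [g (X n.+1)] given the past and [Y n]. *)
Definition move g o := acc w (X n o) (Y n o) * g (Y n o) +
  (1 - acc w (X n o) (Y n o)) * g (X n o).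

Lemma measurable_move g : measurable_fun setT g -> measurable_fun setT (move g).
Proof.
move=> mg.
have ma : measurable_fun setT (fun o => acc w (X n o) (Y n o)).
  exact: (measurableT_comp (measurable_acc2 mw w_gt0)
    (measurable_fun_pair (measurable_funPT (X n)) (measurable_funPT (Y n)))).
apply: measurable_funD; apply: measurable_funM => //.
- exact: measurableT_comp.
- exact: measurable_funB.
- exact: measurableT_comp.
Qed.

Lemma move_ge0 g o : (forall x, 0 <= g x) -> 0 <= move g o.
Proof.
by move=> g0; rewrite addr_ge0// mulr_ge0// ?acc_ge0// subr_ge0 acc_le1.
Qed.

End one_step.

Let mQT : fine (Q setT) = 1.
Proof. by rewrite probability_setT. Qed.

Lemma intg_indic C : measurable C -> intg Q (\1_C : T -> R).
Proof.
move=> mC; apply: (le_intg _ _ (intg_cst Q 1)) => //.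
by move=> x; rewrite ger0_norm// indicE lern1 leq_b1.
Qed.

Lemma EFin_metropolis g x : intg Q g -> (metropolis Q w g x)%:E =
  (\int[Q]_y (acc w x y * g y + (1 - acc w x y) * g x)%:E)%E.
Proof. by move=> jg; rewrite -(EFin_Rintegral (intg_move mw w_gt0 x jg)). Qed.

(** Stationarity: [chainP] with trivial past and proposal events expresses the law of [X n.+1] as
    the integral of [P 1_A] against the law of [X n], and invariance removes [P]. *)
Lemma law_X n A : measurable A ->
  (P (X n @^-1` A) = \int[Q]_(x in A) (w x)%:E)%E.
Proof.
elim: n A => [|n ih] A mA; first exact: law_X0.
have := chainP (@hist_setT n) measurableT mA.
rewrite preimage_setT !setTI => ->.
have jA := intg_indic mA.
have jm : intg Q (metropolis Q w \1_A).
  have := intg_metropolis mw w_gt0 (intg_cst Q 1) jA.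
  have E h : (fun x : T => 1 * h x) = h :> (T -> R).
    by apply/funext => x; rewrite mul1r.
  by rewrite !E; exact.
under eq_integral do rewrite -EFin_metropolis//.
have w_ge0 x : 0 <= w x by exact: ltW.
rewrite -EFin_Rintegral; last exact: (intg_law mw w_ge0 wB B_gt0 ih jm).
rewrite (Rintegral_law mw w_ge0 wB B_gt0 ih jm).
rewrite (Rintegral_metropolis mw w_gt0 wB B1)// EFin_Rintegral; last first.
  exact: (intgw mw w_gt0 wB B1).
rewrite [RHS]integral_mkcond; apply: eq_integral => x _.
by rewrite epatch_indic.
Qed.

Let w_ge0 x : 0 <= w x. Proof. exact: ltW. Qed.

Lemma sqint_X n g : sqint Q g -> sqint P (fun o => g (X n o)).
Proof. exact: (sqint_law mw w_ge0 wB B_gt0 (@law_X n)). Qed.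

Lemma intg_X n g : intg Q g -> intg P (fun o => g (X n o)).
Proof. exact: (intg_law mw w_ge0 wB B_gt0 (@law_X n)). Qed.

Lemma Rintegral_X n g : intg Q g ->
  \int[P]_o g (X n o) = \int[Q]_x (w x * g x).
Proof. exact: (Rintegral_law mw w_ge0 wB B_gt0 (@law_X n)). Qed.

Section one_step_expectation.
Context d1 (S : measurableType d1) (n : nat) (V : {mfun Om >-> S}).
Hypothesis aV : adapted n V.

(** Averaging over [Y n], independent of the past, turns [move] into the Metropolis operator. [V] is
    paired with [X n] because the acceptance weight depends on [X n]. *)
Lemma Rintegral_move (u : S -> R) g : measurable_fun setT u -> intg Q g ->
  intg P (fun o => `|u (V o)| * (\int[Q]_y `|g y| + `|g (X n o)|)) ->
  [/\ intg P (fun o => u (V o) * move n g o),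
      intg P (fun o => u (V o) * metropolis Q w g (X n o)) &
      \int[P]_o (u (V o) * move n g o) =
      \int[P]_o (u (V o) * metropolis Q w g (X n o))].
Proof.
move=> mu jg jh; have mg := intg_mfun jg.
have aVX := adapted_pair aV (adaptedX (leqnn n)).
pose phi (p : (S * T) * T) := u p.1.1 *
  (acc w p.1.2 p.2 * g p.2 + (1 - acc w p.1.2 p.2) * g p.1.2).
have jphi v : intg Q (fun y => phi (v, y)).
  by rewrite /phi/=; apply: intgZ; exact: (intg_move mw w_gt0).
have m12 : measurable_fun setT (fun p : (S * T) * T => p.1.2).
  by apply: measurableT_comp => //; exact: measurable_snd.
have mphi : measurable_fun setT phi.
  have ma : measurable_fun setT (fun p : (S * T) * T => acc w p.1.2 p.2).
    exact: (measurableT_comp (measurable_acc2 mw w_gt0)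
      (measurable_fun_pair m12 measurable_snd)).
  apply: measurable_funM.
    apply: (measurableT_comp mu).
    by apply: measurableT_comp => //; exact: measurable_fst.
  apply: measurable_funD; apply: measurable_funM => //.
  - exact: measurableT_comp.
  - exact: measurable_funB.
  - exact: measurableT_comp.
have bound v : \int[Q]_y `|phi (v, y)| <=
    `|u v.1| * (\int[Q]_y `|g y| + `|g v.2|).
  have jm := intg_move mw w_gt0 v.2 jg.
  rewrite -[X in _ + X]mulr1 -[X in _ + _ * X]mQT.
  rewrite -Rintegral_cst// -RintegralD//; last 2 first.
  - exact: integrable_norm.
  - exact: intg_cst.
  rewrite -RintegralZl//; last first.
    by apply: intgD; [exact: integrable_norm|exact: intg_cst].
  apply: le_Rintegral => //.
  - exact: integrable_norm.
  - by apply: intgZ; apply: intgD; [exact: integrable_norm|exact: intg_cst].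
  - move=> y _; rewrite /phi normrM ler_wpM2l//.
    rewrite (le_trans (ler_normD _ _))// lerD// normrM ler_piMl//.
      exact: normr_acc.
    exact: normr_rej.
have [j1 j2 E] := Rintegral_VY aVX mphi jphi bound jh.
have phiE : (fun o => \int[Q]_y phi (pair_mfun V (X n) o, y)) =
    fun o => u (V o) * metropolis Q w g (X n o).
  apply/funext => o.
  by rewrite /phi/= RintegralZl//; exact: (intg_move mw w_gt0).
by rewrite phiE in j2 E.
Qed.

(** Both sides equal the integral of [P 1_C (X n)] over the event [V \in A]: the left by [chainP]
    with unconstrained proposal, the right by averaging over [Y n]. *)
Lemma integral_step_indic A C : measurable A -> measurable C ->
  (\int[P]_o (\1_A (V o) * \1_C (X n.+1 o))%:E =
   \int[P]_o (\1_A (V o) * move n \1_C o)%:E)%E.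
Proof.
move=> mA mC; have jC := intg_indic mC.
have mIA : measurable_fun setT (\1_A : S -> R) by [].
have [|j1 j2 E] := Rintegral_move mIA jC.
  apply: (le_intg _ _ (intg_cst P (\int[Q]_y `|\1_C y| + 1))).
    apply: measurable_funM; first by do 2 apply: measurableT_comp => //.
    by apply: measurable_funD => //; do 2 apply: measurableT_comp => //.
  have i1 (D : set T) z : `|\1_D z : R| <= 1.
    by rewrite ger0_norm// indicE lern1 leq_b1.
  have i1' (D : set S) z : `|\1_D z : R| <= 1.
    by rewrite ger0_norm// indicE lern1 leq_b1.
  move=> o; rewrite ger0_norm; last first.
    by rewrite mulr_ge0// addr_ge0// Rintegral_ge0.
  rewrite -[leRHS]mul1r ler_pM//; last by rewrite lerD2l.
  by rewrite addr_ge0// Rintegral_ge0.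
rewrite -(EFin_Rintegral j1) E (EFin_Rintegral j2).
have E2 : (P (V @^-1` A `&` X n.+1 @^-1` C) =
    \int[P]_(o in V @^-1` A) (metropolis Q w \1_C (X n o))%:E)%E.
  have := chainP (aV mA) measurableT mC; rewrite preimage_setT setIT => ->.
  by apply: eq_integral => o _; rewrite EFin_metropolis.
transitivity (P (V @^-1` A `&` X n.+1 @^-1` C)).
  have mAC : measurable (V @^-1` A `&` X n.+1 @^-1` C).
    by apply: measurableI; rewrite -[X in measurable X]setTI; exact: measurable_funPT.
  have := integral_indic P measurableT mAC; rewrite setIT => <-.
  by apply: eq_integral => o _; rewrite indicI.
rewrite E2 [LHS]integral_mkcond; apply: eq_integral => o _.
by rewrite epatch_indic/= -EFinM mulrC.
Qed.

(** The identity is bilinear in [(u, g)], so it is extended from indicators in one argument at a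
    time. *)
Lemma ge0_integral_step (u : S -> R) g : measurable_fun setT u ->
  (forall x, 0 <= u x) -> measurable_fun setT g -> (forall x, 0 <= g x) ->
  (\int[P]_o (u (V o) * g (X n.+1 o))%:E =
   \int[P]_o (u (V o) * move n g o)%:E)%E.
Proof.
move=> mu u0 mg g0.
have ma : measurable_fun setT (fun o => acc w (X n o) (Y n o)).
  exact: (measurableT_comp (measurable_acc2 mw w_gt0)
    (measurable_fun_pair (measurable_funPT (X n)) (measurable_funPT (Y n)))).
have a0 o : 0 <= acc w (X n o) (Y n o) by exact: acc_ge0.
have b0 o : 0 <= 1 - acc w (X n o) (Y n o) by rewrite subr_ge0 acc_le1.
have mV : measurable_fun setT V by exact: measurable_funPT.
have mX i : measurable_fun setT (X i) by exact: measurable_funPT.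
have mY i : measurable_fun setT (Y i) by exact: measurable_funPT.
have indic A (h : T -> R) : measurable A -> measurable_fun setT h -> (forall x, 0 <= h x) ->
    (\int[P]_o (\1_A (V o) * h (X n.+1 o))%:E =
     \int[P]_o (\1_A (V o) * move n h o)%:E)%E.
  move=> mA mh h0.
  pose IA o : R := \1_A (V o).
  have mIA : measurable_fun setT IA by exact: measurableT_comp.
  have ok1 : two_point_ok IA (fun=> 0) (X n.+1) (X n) by split.
  have ok2 : two_point_ok (fun o => IA o * acc w (X n o) (Y n o))
      (fun o => IA o * (1 - acc w (X n o) (Y n o))) (Y n) (X n).
    split => //; split; try by move=> o; rewrite mulr_ge0.
      exact: measurable_funM.
    by apply: measurable_funM => //; exact: measurable_funB.
  have E := eq_integral_two_point ok1 ok2 _ mh h0.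
  transitivity (\int[P]_o (two_point IA (fun=> 0) (X n.+1) (X n) h o)%:E)%E.
    by apply: eq_integral => o _; rewrite /two_point mul0r addr0.
  rewrite E; first by apply: eq_integral => o _; rewrite /two_point /move; congr EFin; ring.
  move=> C mC; transitivity (\int[P]_o (\1_A (V o) * \1_C (X n.+1 o))%:E)%E.
    by apply: eq_integral => o _; rewrite /two_point mul0r addr0.
  rewrite integral_step_indic//.
  by apply: eq_integral => o _; rewrite /two_point /move; congr EFin; ring.
have mm : measurable_fun setT (move n g) by exact: measurable_move.
have mgX : measurable_fun setT (fun o => g (X n.+1 o)) by exact: measurableT_comp.
(* The roles are exchanged: [g] is now absorbed in the weight and [u] is the function that varies,
   the second point being given weight 0. *)
have ok1 : two_point_ok (fun o => g (X n.+1 o)) (fun=> 0) V V by split.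
have ok2 : two_point_ok (move n g) (fun=> 0) V V.
  by split => //; split => // o; exact: move_ge0.
transitivity (\int[P]_o (two_point (fun o => g (X n.+1 o)) (fun=> 0) V V u o)%:E)%E.
  by apply: eq_integral => o _; rewrite /two_point mul0r addr0 mulrC.
rewrite (eq_integral_two_point ok1 ok2)//.
  by apply: eq_integral => o _; rewrite /two_point mul0r addr0 mulrC.
move=> A mA; under eq_integral do rewrite /two_point mul0r addr0 mulrC.
rewrite indic//.
by apply: eq_integral => o _; rewrite /two_point mul0r addr0 mulrC.
Qed.

End one_step_expectation.

(** Written with the density 1 so that the results on laws with a bounded density also apply to
    proposals. *)
Lemma law_Y n A : measurable A ->
  (P (Y n @^-1` A) = \int[Q]_(x in A) (cst 1 x)%:E)%E.
Proof.
move=> mA; have := chainP (@hist_setT n) mA measurableT.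
rewrite preimage_setT setTI setIT => ->.
transitivity (\int[P]_o cst (\int[Q]_(x in A) (cst 1 x)%:E) o)%E.
  apply: eq_integral => o _.
  by apply: eq_integral => y _; rewrite !indicT !mulr1 addrC subrK.
rewrite (integral_cst P measurableT) -[RHS]mule1; congr (_ * _)%E.
exact: probability_setT.
Qed.

Lemma sqint_Y n g : sqint Q g -> sqint P (fun o => g (Y n o)).
Proof.
have m1 : measurable_fun setT (cst 1 : T -> R) by [].
apply: (@sqint_law _ _ _ _ _ P Q (cst 1) 1 m1 _ _ ltr01 (Y n) (@law_Y n) g) => x.
- exact: ler01.
- exact: lexx.
Qed.

Lemma sqint_move n g : sqint Q g -> sqint P (move n g).
Proof.
move=> sg; have [mg _] := sg.
have sX := sqint_X n sg; have sY := sqint_Y n sg.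
apply: (sqint_le _ (sqintD (sqint_norm sX) (sqint_norm sY))).
  exact: measurable_move.
move=> o; rewrite [leRHS]ger0_norm; last by rewrite addr_ge0.
rewrite (le_trans (ler_normD _ _))// addrC lerD// normrM ler_piMl//.
  exact: normr_rej.
exact: normr_acc.
Qed.

Section one_step_covariance.
Context d1 (S : measurableType d1) (n : nat) (V : {mfun Om >-> S}).
Hypothesis aV : adapted n V.
Implicit Types u : S -> R.

(** The Markov property tested against a variable of the past. The discrepancy [D] is linear in [g],
    so [K2] removes the sign condition on [g]; then [K3] removes the one on [u]. *)
Lemma Rintegral_step u g : measurable_fun setT u ->
  sqint P (fun o => u (V o)) -> sqint Q g ->
  \int[P]_o (u (V o) * g (X n.+1 o)) =
  \int[P]_o (u (V o) * metropolis Q w g (X n o)).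
Proof.
pose D g o := g (X n.+1 o) - move n g o.
have sD h : sqint Q h -> sqint P (D h).
  by move=> sh; apply: sqintB; [exact: sqint_X|exact: sqint_move].
have K1 u' h : measurable_fun setT u' -> sqint P (fun o => u' (V o)) -> sqint Q h ->
    (forall v, 0 <= u' v) -> (forall x, 0 <= h x) ->
    \int[P]_o (u' (V o) * D h o) = 0.
  move=> mu su sh u0 h0; have [mh _] := sh.
  under eq_Rintegral do rewrite mulrBr.
  rewrite RintegralB//.
  - rewrite /Rintegral ge0_integral_step//; exact: subrr.
  - by apply: sqintM => //; exact: sqint_X.
  - by apply: sqintM => //; exact: sqint_move.
have posn (z : R) : 0 <= z + `|z| by rewrite -lerBlDl sub0r -normrN ler_norm.
have K2 u' h : measurable_fun setT u' -> sqint P (fun o => u' (V o)) -> sqint Q h ->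
    (forall v, 0 <= u' v) -> \int[P]_o (u' (V o) * D h o) = 0.
  move=> mu su sh u0.
  have sn := sqint_norm sh; have sp := sqintD sh sn.
  transitivity (\int[P]_o (u' (V o) * D (fun x => h x + `|h x|) o -
                         u' (V o) * D (fun x => `|h x|) o)).
    by apply: eq_Rintegral => o _; rewrite /D /move; ring.
  rewrite RintegralB//; [|by apply: sqintM => //; exact: sD..].
  by rewrite !K1// subrr.
move=> mu su sg.
have mn : measurable_fun setT (fun v => `|u v|) by exact: measurableT_comp.
have sn := sqint_norm su; have sp := sqintD su sn.
have K3 : \int[P]_o (u (V o) * D g o) = 0.
  transitivity (\int[P]_o ((u (V o) + `|u (V o)|) * D g o - `|u (V o)| * D g o)).
    by apply: eq_Rintegral => o _; ring.
  rewrite RintegralB//; [|by apply: sqintM => //; exact: sD..].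
  rewrite (K2 (fun v => u v + `|u v|))//; last exact: measurable_funD.
  by rewrite (K2 (fun v => `|u v|))// subrr.
have jm : intg P (fun o => u (V o) * move n g o).
  by apply: sqintM => //; exact: sqint_move.
have [|_ _ <-] := Rintegral_move aV mu (sqint_intg sg).
  apply: sqintM => //; apply: sqintD; first exact: sqint_cst.
  by apply: sqint_norm; exact: sqint_X.
apply/eqP; rewrite -subr_eq0 -RintegralB//; last first.
  by apply: sqintM => //; exact: sqint_X.
by rewrite -[X in _ == X]K3; apply/eqP; apply: eq_Rintegral => o _; rewrite mulrBr.
Qed.

End one_step_covariance.

Definition transition n := pair_mfun (pair_mfun (X n) (Y n)) (X n.+1).

(** Stationarity of the single [X n] would not suffice for covariances, because [(X n, Y n)] and
    [X n.+1] are dependent through the acceptance step; their joint law is needed. *)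
Lemma law_transition n E : measurable E ->
  distribution P (transition n) E = distribution P (transition 0) E.
Proof.
apply: eq_measure_rect.
  by rewrite (le_lt_trans (probability_le1 _ _))// ltry.
move=> E1 C mE1 mC.
have mXC k : measurable (X k @^-1` C).
  by rewrite -[X in measurable X]setTI; exact: measurable_funPT.
(* With [C] fixed, restricting [P] to [X k.+1 \in C] gives a finite measure on pairs, to which
   uniqueness on rectangles applies a second time. *)
pose m k := pushforward (mrestr P (mXC k.+1)) (pair_mfun (X k) (Y k)).
suff : m n E1 = m 0 E1 by [].
move: E1 mE1; apply: eq_measure_rect.
  have mS : measurable (pair_mfun (X n) (Y n) @^-1` setT `&` X n.+1 @^-1` C).
    by rewrite preimage_setT setTI; exact: mXC.
  exact: (le_lt_trans (probability_le1 P mS) (ltry 1)).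
move=> A A' mA mA'.
have jC := intg_indic mC.
pose k x := \int[Q]_y (\1_A' y * (acc w x y * \1_C y + (1 - acc w x y) * \1_C x)).
have jk x : intg Q (fun y => \1_A' y * (acc w x y * \1_C y + (1 - acc w x y) * \1_C x)).
  apply: intg_bounded => //; last exact: (intg_move mw w_gt0).
  by move=> y; rewrite ger0_norm// indicE lern1 leq_b1.
have mk : measurable_fun setT k.
  have ma := measurable_acc2 mw w_gt0.
  apply: (measurable_Rintegral2 (phi := fun p : T * T => \1_A' p.2 *
    (acc w p.1 p.2 * \1_C p.2 + (1 - acc w p.1 p.2) * \1_C p.1))) => //.
  apply: measurable_funM; first by apply: measurableT_comp.
  apply: measurable_funD; apply: measurable_funM => //.
  - by apply: measurableT_comp.
  - exact: measurable_funB.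
  - by apply: measurableT_comp.
have k0 x : 0 <= k x.
  apply: Rintegral_ge0 => y _; rewrite mulr_ge0// addr_ge0// mulr_ge0//.
    exact: acc_ge0.
  by rewrite subr_ge0 acc_le1.
(* The right-hand side is free of [i], which enters only through the stationary law of [X i]. *)
suff mE i : m i (A `*` A') = (\int[Q]_x (\1_A x * k x * w x)%:E)%E.
  exact: (etrans (mE n) (esym (mE 0%N))).
transitivity (P (X i @^-1` A `&` Y i @^-1` A' `&` X i.+1 @^-1` C)) => //.
rewrite chainP//; last by apply: adaptedX.
rewrite -(ge0_integral_law mw w_ge0 (@law_X i) (f := fun x => \1_A x * k x)).
- rewrite [LHS]integral_mkcond; apply: eq_integral => o _.
  rewrite epatch_indic/= mulrC EFinM; congr (_ * _)%E.
  rewrite /k (EFin_Rintegral (jk _)) [LHS]integral_mkcond; apply: eq_integral => y _.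
  by rewrite epatch_indic/= muleC [RHS]EFinM.
- exact: measurable_funM.
- by move=> x; rewrite mulr_ge0.
Qed.

(** * Partial sums of a functional of state and proposal *)

Section functional.
Variable U : T * T -> R.
Hypotheses (mU : measurable_fun setT U)
  (sU : forall x, sqint Q (fun y => U (x, y)))
  (jUU : intg Q (fun x => \int[Q]_y (U (x, y) ^+ 2))).

Let xi n o := U (X n o, Y n o).
Let Uh x := \int[Q]_y U (x, y).
Let c0 := \int[Q]_x (w x * \int[Q]_y (U (x, y) ^+ 2)).

(** Jensen's inequality in [y]. Only the second moments of [G] have to match those of [U], so that
    both [U] and [|U|] are covered. *)
Let sqint_mean (G : T * T -> R) : measurable_fun setT G ->
  (forall x, sqint Q (fun y => G (x, y))) ->
  (forall x, \int[Q]_y (G (x, y) ^+ 2) = \int[Q]_y (U (x, y) ^+ 2)) ->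
  sqint Q (fun x => \int[Q]_y G (x, y)).
Proof.
move=> mG sG GU.
have mh : measurable_fun setT (fun x => \int[Q]_y G (x, y)).
  by apply: (measurable_Rintegral2 mG) => x; exact: sqint_intg (sG x).
split => //; apply: le_intg jUU; first exact: measurable_funX.
by move=> x; rewrite ger0_norm ?sqr_ge0// -GU sqr_Rintegral_le.
Qed.

Lemma sqint_Uh : sqint Q Uh.
Proof. exact: sqint_mean. Qed.

Lemma sqint_xi n : sqint P (xi n) /\ \int[P]_o (xi n o ^+ 2) = c0.
Proof.
have mU2 : measurable_fun setT (fun p => U p ^+ 2) by exact: measurable_funX.
have [||j1 j2 E] := Rintegral_VY (adaptedX (leqnn n)) mU2 (fun x => (sU x).2)
    (h := fun x => \int[Q]_y (U (x, y) ^+ 2)).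
- move=> x; rewrite le_eqVlt; apply/orP; left; apply/eqP.
  by apply: eq_Rintegral => y _; rewrite ger0_norm// sqr_ge0.
- exact: (intg_X n jUU).
split; last by rewrite /xi E (Rintegral_X n jUU).
split => //; apply: (measurableT_comp mU).
exact: measurable_fun_pair (measurable_funPT (X n)) (measurable_funPT (Y n)).
Qed.

Lemma xi_mean n : \int[P]_o xi n o = \int[Q]_x (w x * Uh x).
Proof.
have mnU : measurable_fun setT (fun p => `|U p|) by exact: measurableT_comp.
have sn : sqint Q (fun x => \int[Q]_y `|U (x, y)|).
  apply: (sqint_mean mnU) => x; first exact: sqint_norm.
  by apply: eq_Rintegral => y _; rewrite real_normK// num_real.
have [||j1 j2 E] := Rintegral_VY (adaptedX (leqnn n)) mU
  (fun x => sqint_intg (sU x)) (h := fun x => \int[Q]_y `|U (x, y)|).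
- by [].
- exact: (intg_X n (sqint_intg sn)).
by rewrite /xi E (Rintegral_X n (sqint_intg sqint_Uh)).
Qed.

Let adaptedXY i n : (i < n)%N -> adapted n (pair_mfun (X i) (Y i)).
Proof.
by move=> i_n; apply: adapted_pair; [apply: adaptedX; exact: ltnW|exact: adaptedY].
Qed.

(** [Y j] is independent of [(X i, Y i, X j)], so [xi j] may be replaced by its mean over the
    proposal. *)
Lemma xi_xi i j : (i < j)%N ->
  \int[P]_o (xi i o * xi j o) = \int[P]_o (xi i o * Uh (X j o)).
Proof.
move=> ij.
have aV := adapted_pair (adaptedXY ij) (adaptedX (leqnn j)).
have mnU : measurable_fun setT (fun p => `|U p|) by exact: measurableT_comp.
have sn : sqint Q (fun x => \int[Q]_y `|U (x, y)|).
  apply: (sqint_mean mnU) => x; first exact: sqint_norm.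
  by apply: eq_Rintegral => y _; rewrite real_normK// num_real.
have m11 : measurable_fun setT (fun p : ((T * T) * T) * T => p.1.1).
  by apply: measurableT_comp => //; exact: measurable_fst.
have m12 : measurable_fun setT (fun p : ((T * T) * T) * T => p.1.2).
  by apply: measurableT_comp => //; exact: measurable_snd.
pose phi (p : ((T * T) * T) * T) := U p.1.1 * U (p.1.2, p.2).
have mphi : measurable_fun setT phi.
  apply: measurable_funM; first exact: (measurableT_comp mU m11).
  exact: (measurableT_comp mU (measurable_fun_pair m12 measurable_snd)).
have jphi v : intg Q (fun y => phi (v, y)).
  by rewrite /phi/=; apply: intgZ; exact: sqint_intg.
have [||j1 j2 E] := Rintegral_VY aV mphi jphi
    (h := fun v => `|U v.1| * \int[Q]_y `|U (v.2, y)|).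
- move=> v; rewrite /phi/=; under eq_Rintegral do rewrite normrM.
  rewrite RintegralZl//; apply: integrable_norm => //; exact: sqint_intg.
- apply: sqintM; last exact: (sqint_X j sn).
  by apply: sqint_norm; have [] := sqint_xi i.
rewrite /xi [LHS]E; apply: eq_Rintegral => o _.
by rewrite /phi/= RintegralZl//; exact: sqint_intg.
Qed.

Let sqint_iter k g : sqint Q g -> sqint Q (iter k (metropolis Q w) g).
Proof. by move=> sg; elim: k => //= k ih; exact: (sqint_metropolis mw w_gt0). Qed.

(** One transition is peeled off at a time, down to [X i.+1] and no further: the step out of [X i]
    uses [Y i], on which [xi i] also depends. *)
Lemma xi_step i k g : sqint Q g ->
  \int[P]_o (xi i o * g (X (i.+1 + k)%N o)) =
  \int[P]_o (xi i o * iter k (metropolis Q w) g (X i.+1 o)).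
Proof.
elim: k g => [|k ih] g sg; first by rewrite addn0.
have ik : (i < i.+1 + k)%N by rewrite addSn ltnS leq_addr.
rewrite addnS (Rintegral_step (adaptedXY ik) mU)//; last by have [] := sqint_xi i.
by rewrite ih ?iterSr//; exact: (sqint_metropolis mw w_gt0).
Qed.

(** The index is shifted: once [U] is centred, [C k] is the covariance at lag [k + 1]. *)
Let C k := \int[P]_o (xi 0 o * iter k (metropolis Q w) Uh (X 1 o)).

Lemma xi_cov i k : \int[P]_o (xi i o * xi (i.+1 + k)%N o) = C k.
Proof.
have ik : (i < i.+1 + k)%N by rewrite addSn ltnS leq_addr.
rewrite xi_xi// xi_step; last exact: sqint_Uh.
set g := iter k _ _; have sg : sqint Q g by apply: sqint_iter; exact: sqint_Uh.
pose phi (p : (T * T) * T) := U p.1 * g p.2.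
have mphi : measurable_fun setT phi.
  have [mg _] := sg.
  by apply: measurable_funM; [apply: (measurableT_comp mU)|apply: (measurableT_comp mg)].
have jphi n : intg P (fun o => phi (transition n o)).
  by apply: sqintM; [case: (sqint_xi n)|exact: (sqint_X n.+1 sg)].
rewrite -[LHS](Rintegral_distribution (V := transition i) mphi (jphi i)).
rewrite -[RHS](Rintegral_distribution (V := transition 0) mphi (jphi 0%N)).
by apply: Rintegral_eq_measure => A mA; exact: law_transition.
Qed.

Let rho := 1 - B^-1.

Let rho01 : 0 < rho < 1.
Proof. by rewrite subr_gt0 invf_lt1// B1/= ltrBlDr ltrDl invr_gt0. Qed.

Hypothesis U0 : \int[Q]_x (w x * Uh x) = 0.

Let iter_contraction k : \int[Q]_x (w x * iter k (metropolis Q w) Uh x) = 0 /\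
  \int[Q]_x (w x * iter k (metropolis Q w) Uh x ^+ 2) <= (rho ^+ k) ^+ 2 * c0.
Proof.
have sh := sqint_Uh.
elim: k => [|k [ih0 ih2]].
  split => //=; rewrite expr0 expr1n mul1r; apply: le_Rintegral => //.
  - by apply: (intgw mw w_gt0 wB B1); case: sh.
  - exact: (intgw mw w_gt0 wB B1).
  - by move=> x _; rewrite ler_wpM2l// sqr_Rintegral_le.
have sk := sqint_iter k sh.
split; first by rewrite (Rintegral_metropolis mw w_gt0 wB B1)//; exact: sqint_intg.
apply: (le_trans (metropolis_contraction mw w_gt0 wB w1 B1 sk ih0)).
by rewrite (exprS rho) exprMn -(mulrA (rho ^+ 2)) ler_wpM2l// sqr_ge0.
Qed.

Let C_le k : `|C k| <= c0 * rho ^+ k.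
Proof.
have /andP[r0 _] := rho01; have rk : 0 < rho ^+ k by rewrite exprn_gt0.
have [s0 E0] := sqint_xi 0.
have sk := sqint_iter k sqint_Uh.
(* The weight [rho ^+ k] balances Young's inequality: the second factor has second moment at most
   [rho^(2k) c0], so both terms become [rho^k c0]. *)
apply: (le_trans (normr_Rintegral_prod_le rk s0 (sqint_X 1 sk))).
rewrite E0 (Rintegral_X 1 sk.2).
have [_ le2] := iter_contraction k.
apply: (@le_trans _ _ (2^-1 * (rho ^+ k * c0 + (rho ^+ k)^-1 * ((rho ^+ k) ^+ 2 * c0)))).
  by rewrite ler_wpM2l ?invr_ge0// lerD2l ler_wpM2l// invr_ge0 ltW.
by rewrite le_eqVlt; apply/orP; left; apply/eqP; field; rewrite gt_eqF.
Qed.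

Lemma second_moment_sum n : sqint P (fun o => \sum_(i < n) xi i o) /\
  \int[P]_o ((\sum_(i < n) xi i o) ^+ 2) = \sum_(m < n) (c0 + 2 * \sum_(k < m) C k).
Proof.
have sx m : sqint P (xi m) by have [] := sqint_xi m.
elim: n => [|n [ihs ih]].
  split; first by under eq_fun do rewrite big_ord0; exact: sqint_cst.
  rewrite big_ord0; under eq_Rintegral do rewrite big_ord0 expr0n.
  by rewrite Rintegral_cst// mul0r.
split; first by under eq_fun do rewrite big_ord_recr; exact: sqintD.
rewrite big_ord_recr/= -ih.
have [_ xn] := sqint_xi n.
transitivity (\int[P]_o ((\sum_(i < n) xi i o) ^+ 2 +
    (xi n o ^+ 2 + 2 * ((\sum_(i < n) xi i o) * xi n o)))).
  by apply: eq_Rintegral => o _; rewrite big_ord_recr/=; ring.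
have jx := sqintM ihs (sx n).
have jn : intg P (fun o => xi n o ^+ 2) by case: (sx n).
rewrite RintegralD//; [|by case: ihs|by apply: intgD => //; exact: intgZ].
rewrite RintegralD//; last exact: intgZ.
rewrite RintegralZl// xn; congr (_ + (_ + _ * _)).
transitivity (\sum_(i < n) \int[P]_o (xi i o * xi n o)).
  have : forall m, (m <= n)%N -> \int[P]_o ((\sum_(i < m) xi i o) * xi n o) =
      \sum_(i < m) \int[P]_o (xi i o * xi n o).
    elim=> [_|m ihm mn].
      rewrite big_ord0; under eq_Rintegral do rewrite big_ord0 mul0r.
      by rewrite Rintegral_cst// mul0r.
    rewrite big_ord_recr/= -ihm ?(ltnW mn)//.
    under eq_Rintegral do rewrite big_ord_recr/= mulrDl.
    rewrite RintegralD//; last exact: sqintM.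
    apply: sqintM => //.
    elim: {ihm mn} m => [|m ihm]; under eq_fun do rewrite ?big_ord0 ?big_ord_recr/=.
      exact: sqint_cst.
    exact: sqintD.
  by apply.
(* Reversing the index matches the pair [(i, n)] with its lag. *)
rewrite [RHS](reindex_inj rev_ord_inj)/=; apply: eq_bigr => i _.
by rewrite -(xi_cov i) subnKC.
Qed.

Lemma xi_sum_mean n : \int[P]_o \sum_(i < n) xi i o = 0.
Proof.
elim: n => [|n ih].
  under eq_Rintegral do rewrite big_ord0.
  by rewrite Rintegral_cst// mul0r.
under eq_Rintegral do rewrite big_ord_recr.
rewrite RintegralD//.
- by rewrite ih xi_mean U0 addr0.
- by apply: sqint_intg; have [] := second_moment_sum n.
- by apply: sqint_intg; have [] := sqint_xi n.
Qed.

Theorem variance_limit (v : nat -> R) :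
  (forall n, v n = n%:R^-1 * \int[P]_o ((\sum_(i < n) xi i o) ^+ 2)) ->
  exists L, [/\ v n @[n --> \oo] --> L, L <= c0 * (1 + 2 * B) &
                (forall k, 0 <= C k) -> c0 <= L].
Proof.
move=> vE; have [L [vL Lc cL]] := @cesaro_geometric R c0 rho C v rho01 C_le
  (fun n => etrans (vE n) (congr1 _ (second_moment_sum n).2)).
exists L; split => //; rewrite (le_trans Lc)// /rho opprB addrCA subrr addr0.
by rewrite invrK.
Qed.

End functional.

Theorem im_limit F m (v : nat -> R) : sqint Q F -> m = \int[Q]_x (w x * F x) ->
  (forall n, v n = n%:R^-1 * \int[P]_o ((\sum_(i < n) (F (X i o) - m)) ^+ 2)) ->
  exists L, v n @[n --> \oo] --> L /\ \int[Q]_x (w x * (F x - m) ^+ 2) <= L.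
Proof.
move=> sF mE vE; pose Fb x := F x - m.
have sFb : sqint Q Fb by apply: sqintB => //; exact: sqint_cst.
pose U (p : T * T) := Fb p.1.
have mU : measurable_fun setT U.
  by apply: (measurableT_comp (f := Fb)) => //; case: sFb.
have sU x : sqint Q (fun y => U (x, y)) by exact: (sqint_cst Q (Fb x)).
have Uc (g : T -> R) x : \int[Q]_y g x = g x by rewrite Rintegral_cst// mQT mulr1.
have UE : (fun x => \int[Q]_y (U (x, y) ^+ 2)) = (fun x => Fb x ^+ 2).
  by apply/funext => x; rewrite (Uc (fun x => Fb x ^+ 2)).
have UhE : (fun x => \int[Q]_y U (x, y)) = Fb by apply/funext => x; rewrite (Uc Fb).
have jUU : intg Q (fun x => \int[Q]_y (U (x, y) ^+ 2)) by rewrite UE; case: sFb.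
have jw := intg_w Q mw w_gt0 wB B1.
have U0 : \int[Q]_x (w x * \int[Q]_y U (x, y)) = 0.
  rewrite (_ : \int[Q]_x _ = \int[Q]_x (w x * F x - m * w x)); last first.
    by apply: eq_Rintegral => x _; rewrite (congr1 (@^~ x) UhE) /Fb; ring.
  rewrite RintegralB//.
  - by rewrite RintegralZl// w1 mulr1 -mE subrr.
  - by apply: (intgw mw w_gt0 wB B1); exact: sqint_intg.
  - exact: intgZ.
have [L [vL _ cL]] := variance_limit mU sU jUU U0 vE.
exists L; split => //.
rewrite (_ : \int[Q]_x _ = \int[Q]_x (w x * \int[Q]_y (U (x, y) ^+ 2))); last first.
  by apply: eq_Rintegral => x _; rewrite (congr1 (@^~ x) UE).
(* Here [U] ignores [y], so the covariance at lag [k + 1] is the quadratic form of [P^(k+1)] at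
   [Fb], nonnegative by positivity. *)
apply: cL => k; rewrite UhE.
have sk : sqint Q (iter k (metropolis Q w) Fb).
  by elim: k => //= k ih; exact: (sqint_metropolis mw w_gt0).
have mFb : measurable_fun setT Fb by case: sFb.
have := Rintegral_step (adaptedX (leqnn 0)) mFb (sqint_X 0 sFb) sk.
rewrite /U/= => ->.
have sk1 := sqint_metropolis mw w_gt0 sk.
rewrite (Rintegral_X 0 (sqintM sFb sk1)).
exact: (iter_metropolis_psd mw w_gt0 wB B1 k.+1 sFb).
Qed.

Definition rejected F (p : T * T) := (1 - acc w p.1 p.2) * (F p.1 - F p.2).

(** The constant [e] is left free because the facts are needed twice: for the centred term, and with
    [e = 0] for the raw one. *)
Let rejected_sub_ok F e : sqint Q F ->
  [/\ measurable_fun setT (fun p => rejected F p - e),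
      forall x, sqint Q (fun y => rejected F (x, y) - e) &
      intg Q (fun x => \int[Q]_y ((rejected F (x, y) - e) ^+ 2))].
Proof.
move=> sF; have [mF F2] := sF.
have mr : measurable_fun setT (fun p => rejected F p - e).
  apply: measurable_funB => //; apply: measurable_funM.
    by apply: measurable_funB => //; exact: (measurable_acc2 mw w_gt0).
  by apply: measurable_funB; apply: measurableT_comp.
have sr x : sqint Q (fun y => rejected F (x, y) - e).
  apply: sqintB; last exact: sqint_cst.
  apply: sqint_bounded; last exact: (sqintB (sqint_cst Q (F x)) sF).
    by apply: measurable_funB => //; exact: (measurable_acc mw).
  by move=> y; exact: normr_rej.
split => //.
have jF2 : intg Q (fun x => F x ^+ 2) by [].
(* From [(z - e)^2 <= 2 z^2 + 2 e^2] and [(F x - F y)^2 <= 2 F x^2 + 2 F y^2], the rejection factor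
   being at most 1. *)
pose h x := 4 * F x ^+ 2 + (4 * \int[Q]_y (F y ^+ 2) + 2 * e ^+ 2).
have jh : intg Q h by apply: intgD; [exact: intgZ|exact: intg_cst].
apply: (le_intg _ _ jh).
  apply: (measurable_Rintegral2 (phi := fun p => (rejected F p - e) ^+ 2)).
    exact: measurable_funX.
  by move=> x; case: (sr x).
move=> x; rewrite ger0_norm; last by apply: Rintegral_ge0 => y _; exact: sqr_ge0.
have -> : h x = \int[Q]_y (4 * F y ^+ 2 + (4 * F x ^+ 2 + 2 * e ^+ 2)).
  rewrite RintegralD//; [|exact: intgZ|exact: intg_cst].
  by rewrite RintegralZl// Rintegral_cst// mQT /h; ring.
apply: le_Rintegral => //.
- by case: (sr x).
- by apply: intgD; [exact: intgZ|exact: intg_cst].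
move=> y _; rewrite /rejected/=; have a0 := acc_ge0 w_gt0 x y.
have a1 := acc_le1 w x y; set r := 1 - _.
have r2 : r ^+ 2 <= 1 by rewrite expr_le1// /r; lra.
have := sqr_ge0 (r * (F x - F y) + e); have := sqr_ge0 (F x + F y).
have := sqr_ge0 (F x - F y).
set d2 := (F x - F y) ^+ 2 => d20 h1 h2.
have h3 : r ^+ 2 * d2 <= d2 by rewrite ler_piMl.
have h4 : (r * (F x - F y)) ^+ 2 = r ^+ 2 * d2 by rewrite exprMn.
have h5 : d2 = F x ^+ 2 - 2 * F x * F y + F y ^+ 2 by rewrite /d2; ring.
move: h4 h2; set z := r * _ => h4 h2; nra.
Qed.

Theorem imcv_limit F : sqint Q F ->
  let e := \int[Q]_x (w x * \int[Q]_y rejected F (x, y)) in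
  let S n o := \sum_(i < n) (rejected F (X i o, Y i o) - e) in
  [/\ forall n, sqint P (S n), forall n, \int[P]_o S n o = 0 &
    forall v : nat -> R, (forall n, v n = n%:R^-1 * \int[P]_o (S n o ^+ 2)) ->
    exists L, v n @[n --> \oo] --> L /\
     L <= \int[Q]_x (w x * \int[Q]_y (rejected F (x, y) ^+ 2)) * (1 + 2 * B)].
Proof.
move=> sF e S.
have [m0 s0 j0] := rejected_sub_ok 0 sF.
have [me se je] := rejected_sub_ok e sF.
have r0 : (fun p => rejected F p - 0) = rejected F by apply/funext => p; rewrite subr0.
have r0x x : (fun y => rejected F (x, y) - 0) = (fun y => rejected F (x, y)).
  by apply/funext => y; rewrite subr0.
have r02 : (fun x => \int[Q]_y ((rejected F (x, y) - 0) ^+ 2)) =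
    (fun x => \int[Q]_y (rejected F (x, y) ^+ 2)).
  by apply/funext => x; apply: eq_Rintegral => y _; rewrite subr0.
have sr x : sqint Q (fun y => rejected F (x, y)) by rewrite -r0x.
rewrite r0 in m0; rewrite r02 in j0.
have jw := intg_w Q mw w_gt0 wB B1.
have sUh := sqint_Uh m0 sr j0.
have U0 : \int[Q]_x (w x * \int[Q]_y (rejected F (x, y) - e)) = 0.
  rewrite (_ : \int[Q]_x _ =
      \int[Q]_x (w x * \int[Q]_y rejected F (x, y) - e * w x)); last first.
    apply: eq_Rintegral => x _; rewrite RintegralB//; [|exact: sqint_intg|exact: intg_cst].
    by rewrite Rintegral_cst// mQT; ring.
  rewrite RintegralB//.
  - by rewrite RintegralZl// w1 mulr1 subrr.
  - by apply: (intgw mw w_gt0 wB B1); exact: sqint_intg.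
  - exact: intgZ.
split.
- by move=> n; have [] := second_moment_sum me se je n.
- by move=> n; exact: (xi_sum_mean me se je U0 n).
move=> v vE; have [L [vL Lc _]] := variance_limit me se je U0 vE.
exists L; split => //; apply: (le_trans Lc); rewrite ler_wpM2r//.
  by rewrite addr_ge0// mulr_ge0// ltW.
(* Both constants are second moments of the summand at time 0 on [Om], with and without centring;
   subtracting the mean can only lower it. *)
have [_ <-] := sqint_xi me se je 0.
have [sx <-] := sqint_xi m0 sr j0 0.
rewrite (Rintegral_centered sx); first by rewrite gerBl sqr_ge0.
by rewrite (xi_mean m0 sr j0).
Qed.

End chain.

(** * Rejections and the Kullback-Leibler divergence *)

(** A pointwise form of Pinsker's inequality, through the Hellinger distance. With [s = sqrt w],
    factor [w - 1 = (s - 1) (s + 1)] and apply Young's inequality; then [(s - 1)^2 <= w - ln w - 1]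
    because [ln s <= s - 1], and [(s + 1)^2 <= 2 (1 + w)]. *)
Lemma norm_sub1_le_ln (R : realType) (w c : R) : 0 < w -> 0 < c ->
  `|w - 1| <= (2 * c)^-1 * (w - ln w - 1) + c * (1 + w).
Proof.
move=> w0 c0; have [s s0 ws] : exists2 s, 0 < s & w = s ^+ 2.
  by exists (Num.sqrt w); rewrite ?sqrtr_gt0// sqr_sqrtr// ltW.
have lns : ln w <= 2 * (s - 1).
  rewrite ws lnXn// -[_ *+ 2]mulr_natl ler_pM2l//.
  have := @le_ln1Dx R (s - 1); rewrite (_ : 1 + (s - 1) = s); last by ring.
  by apply; lra.
apply: (@le_trans _ _ ((2 * c)^-1 * (s - 1) ^+ 2 + c * (1 + w))); last first.
  have c2 : 0 <= (2 * c)^-1 by rewrite invr_ge0 mulr_ge0// ltW.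
  rewrite lerD2r ler_wpM2l//.
  have -> : (s - 1) ^+ 2 = w - 2 * (s - 1) - 1 by rewrite ws; ring.
  by rewrite lerD2r lerD2l lerN2.
have -> : w - 1 = (s - 1) * (s + 1) by rewrite ws; ring.
rewrite normrM (ger0_norm (x := s + 1)); last by lra.
set a := `|s - 1|; have -> : (s - 1) ^+ 2 = a ^+ 2 by rewrite real_normK// num_real.
have : (s + 1) ^+ 2 <= 2 * (1 + w).
  by rewrite ws; have := sqr_ge0 (s - 1); lra.
set b := s + 1 => b2.
have -> : (2 * c)^-1 * a ^+ 2 = c / 2 * (a / c) ^+ 2.
  by field; rewrite gt_eqF.
have -> : a * b = c * ((a / c) * b) by field; rewrite gt_eqF.
have := sqr_ge0 (a / c - b); set x := a / c => xb.
have := ler_wpM2l (ltW c0) xb; have := ler_wpM2l (ltW c0) b2; rewrite mulr0; lra.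
Qed.

Section rejection_bound.
Context d (T : measurableType d) (R : realType).
Variables (Q : probability T R) (w : T -> R) (B : R).
Hypotheses (mw : measurable_fun setT w) (w_gt0 : forall x, 0 < w x)
  (wB : forall x, w x <= B) (w1 : \int[Q]_x w x = 1) (B1 : 1 < B).
Implicit Types F : T -> R.

Let B_gt0 : 0 < B. Proof. exact: lt_trans B1. Qed.
Let fineQT : fine (Q setT) = 1. Proof. by rewrite probability_setT. Qed.

Let sqint_rejected F x : sqint Q F -> sqint Q (fun y => rejected w F (x, y)).
Proof.
move=> sF; apply: sqint_bounded; last exact: (sqintB (sqint_cst Q (F x)) sF).
  by apply: measurable_funB => //; exact: (measurable_acc mw).
by move=> y; exact: normr_rej.
Qed.

Let Rintegral_affine F b c : intg Q F ->
  intg Q (fun x => b * F x + c) /\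
  \int[Q]_x (b * F x + c) = b * \int[Q]_x F x + c.
Proof.
move=> jF; have jb := intgZ b jF; have jc := intg_cst Q c.
split; first exact: intgD.
by rewrite RintegralD// RintegralZl// Rintegral_cst// fineQT mulr1.
Qed.

Let measurable_rejected2 F : sqint Q F ->
  measurable_fun setT (fun x => \int[Q]_y (rejected w F (x, y) ^+ 2)).
Proof.
move=> sF; have [mF _] := sF.
apply: (measurable_Rintegral2 (phi := fun p => rejected w F p ^+ 2)).
  apply: measurable_funX; apply: measurable_funM.
    by apply: measurable_funB => //; exact: (measurable_acc2 mw w_gt0).
  by apply: measurable_funB; apply: measurableT_comp.
by move=> x; have [] := sqint_rejected x sF.
Qed.

(** The weight [w x * (1 - acc x y)] is the positive part of [w x - w y], hence at most
    [|w x - 1| + |w y - 1|] and also at most [B]. With [t = (F x - F y)^2 <= K + t^2 / (4 K)], the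
    small bound is used on [K] and the crude one on the fourth-order term. *)
Lemma rejected_le_variation F K : sqint Q F -> intg Q (fun x => F x ^+ 4) -> 0 < K ->
  \int[Q]_x (w x * \int[Q]_y (rejected w F (x, y) ^+ 2)) <=
  2 * K * \int[Q]_x `|w x - 1| + 4 * B / K * \int[Q]_x (F x ^+ 4).
Proof.
move=> sF j4 K0; have [mF _] := sF; have jw := intg_w Q mw w_gt0 wB B1.
have j1 : intg Q (fun x => `|w x - 1|).
  by apply: integrable_norm; apply: intgB => //; exact: intg_cst.
set tv := \int[Q]_x `|w x - 1|; set G := \int[Q]_x (F x ^+ 4).
pose h x := K * `|w x - 1| + (2 * B / K * F x ^+ 4 + (K * tv + 2 * B / K * G)).
have jh0 : intg Q (fun x => 2 * B / K * F x ^+ 4 + (K * tv + 2 * B / K * G)).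
  by have [] := Rintegral_affine (2 * B / K) (K * tv + 2 * B / K * G) j4.
have jh : intg Q h by apply: intgD => //; exact: intgZ.
have -> : 2 * K * tv + 4 * B / K * G = \int[Q]_x h x.
  rewrite RintegralD//; last exact: intgZ.
  rewrite RintegralZl//.
  have [_ ->] := Rintegral_affine (2 * B / K) (K * tv + 2 * B / K * G) j4.
  by rewrite -/tv -/G; field; rewrite gt_eqF.
have pt x : w x * \int[Q]_y (rejected w F (x, y) ^+ 2) <= h x.
  have [_ jr] := sqint_rejected x sF.
  have -> : h x = \int[Q]_y (K * `|w y - 1| +
      (2 * B / K * F y ^+ 4 + (K * `|w x - 1| + 2 * B / K * F x ^+ 4))).
    have [jq Eq] := Rintegral_affine (2 * B / K) (K * `|w x - 1| + 2 * B / K * F x ^+ 4) j4.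
    rewrite RintegralD//; last exact: intgZ.
    by rewrite RintegralZl// Eq -/tv -/G /h; ring.
  rewrite -RintegralZl//; apply: le_Rintegral => //.
  - exact: intgZ.
  - apply: intgD; first exact: intgZ.
    by have [] := Rintegral_affine (2 * B / K) (K * `|w x - 1| + 2 * B / K * F x ^+ 4) j4.
  move=> y _; rewrite /rejected/= exprMn.
  set t := (F x - F y) ^+ 2; have t0 : 0 <= t by exact: sqr_ge0.
  have a0 := acc_ge0 w_gt0 x y; have a1 := acc_le1 w x y.
  pose del := w x - Num.min (w x) (w y).
  have delE : w x * (1 - acc w x y) = del by rewrite mulrBr mulr1 mul_acc.
  have del0 : 0 <= del by rewrite subr_ge0 ge_min lexx.
  have delB : del <= B.
    by rewrite lerBlDr (le_trans (wB x))// lerDl le_min !ltW.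
  have del1 : del <= `|w x - 1| + `|w y - 1|.
    rewrite /del minEle; case: ifP => _; first by rewrite subrr addr_ge0.
    rewrite (_ : w x - w y = (w x - 1) - (w y - 1)); last by ring.
    by rewrite (le_trans (ler_norm _))// ler_normB.
  have t2 : t ^+ 2 <= 8 * (F x ^+ 4 + F y ^+ 4).
    have := sqr_ge0 (F x + F y); have := sqr_ge0 (F x ^+ 2 - F y ^+ 2).
    set a := F x; set b := F y => h1 h2.
    have q1 : t <= 2 * (a ^+ 2 + b ^+ 2) by rewrite /t -/a -/b; lra.
    have : t ^+ 2 <= (2 * (a ^+ 2 + b ^+ 2)) ^+ 2 by rewrite lerXn2r ?nnegrE//; lra.
    lra.
  have tK : t <= K + (4 * K)^-1 * t ^+ 2.
    have -> : K + (4 * K)^-1 * t ^+ 2 = t + (4 * K)^-1 * (t - 2 * K) ^+ 2.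
      by field; rewrite gt_eqF.
    by rewrite lerDl mulr_ge0 ?sqr_ge0// invr_ge0 mulr_ge0// ltW.
  apply: (@le_trans _ _ (del * t)).
    rewrite -delE -mulrA ler_wpM2l ?(ltW (w_gt0 x))// ler_wpM2r// expr2 ler_piMl//; lra.
  apply: (@le_trans _ _ (del * K + del * ((4 * K)^-1 * t ^+ 2))).
    by rewrite -mulrDr ler_wpM2l.
  apply: (@le_trans _ _ ((`|w x - 1| + `|w y - 1|) * K +
      B * ((4 * K)^-1 * (8 * (F x ^+ 4 + F y ^+ 4))))).
    rewrite lerD//; first by rewrite ler_wpM2r// ltW.
    have k4 : 0 <= (4 * K)^-1 by rewrite invr_ge0 mulr_ge0// ltW.
    apply: ler_pM => //; first by rewrite mulr_ge0 ?sqr_ge0.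
    by rewrite ler_wpM2l.
  by rewrite le_eqVlt; apply/orP; left; apply/eqP; field; rewrite gt_eqF.
apply: le_Rintegral => //.
apply: (le_intg _ _ jh); first by apply: measurable_funM => //; exact: measurable_rejected2.
move=> x; rewrite ger0_norm//; rewrite mulr_ge0 ?(ltW (w_gt0 x))//.
by apply: Rintegral_ge0 => y _; exact: sqr_ge0.
Qed.

(** The degenerate case, out of reach of smallness of the divergence. As [w > 0], [F = m] holds
    [Q]-almost everywhere, and differences of values of [F] vanish almost surely. *)
Lemma rejected_eq0 F m : sqint Q F -> \int[Q]_x (w x * (F x - m) ^+ 2) = 0 ->
  \int[Q]_x (w x * \int[Q]_y (rejected w F (x, y) ^+ 2)) <= 0.
Proof.
move=> sF F0; have jw := intg_w Q mw w_gt0 wB B1.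
have [mFm j2] := sqintB sF (sqint_cst Q m).
have jw2 := intgw mw w_gt0 wB B1 j2.
have V0 : \int[Q]_x ((F x - m) ^+ 2) = 0.
  have ae0 : ae_eq Q setT (fun x => (w x * (F x - m) ^+ 2)%:E) (cst 0%E).
    have mf : measurable_fun setT (fun x => (w x * (F x - m) ^+ 2)%:E).
      by case/integrableP: jw2.
    apply: (proj1 (ae_eq_integral_abs Q measurableT mf)).
    rewrite -[RHS](congr1 EFin F0) (EFin_Rintegral jw2); apply: eq_integral => x _ /=.
    by rewrite ger0_norm// mulr_ge0 ?sqr_ge0 ?(ltW (w_gt0 x)).
  rewrite /Rintegral (ae_eq_integral (cst 0%E))//.
  - by rewrite integral0.
  - by case/integrableP: j2.
  - apply: filterS ae0 => x /= h /h [] /eqP.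
    by rewrite mulf_eq0 gt_eqF//= => /eqP ->.
(* Writing 0 this way allows a bound at every [x], with no null sets in the product space. *)
rewrite (_ : 0 = \int[Q]_x (2 * (w x * (F x - m) ^+ 2))); last first.
  by rewrite RintegralZl// F0 mulr0.
have pt x : \int[Q]_y (rejected w F (x, y) ^+ 2) <= 2 * (F x - m) ^+ 2.
  have -> : 2 * (F x - m) ^+ 2 = \int[Q]_y (2 * (F y - m) ^+ 2 + 2 * (F x - m) ^+ 2).
    by have [_ ->] := Rintegral_affine 2 (2 * (F x - m) ^+ 2) j2; rewrite V0; ring.
  apply: le_Rintegral => //.
  - by have [] := sqint_rejected x sF.
  - by have [] := Rintegral_affine 2 (2 * (F x - m) ^+ 2) j2.
  move=> y _; rewrite /rejected/= exprMn.
  apply: (@le_trans _ _ ((F x - F y) ^+ 2)).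
    have a0 := acc_ge0 w_gt0 x y; have a1 := acc_le1 w x y.
    by rewrite ler_piMl ?sqr_ge0// expr_le1//; lra.
  have := sqr_ge0 ((F y - m) + (F x - m)); lra.
apply: le_Rintegral => //; last first.
- by move=> x _; rewrite mulrCA ler_wpM2l// ltW.
- exact: intgZ.
apply: (intgw mw w_gt0 wB B1); apply: (le_intg _ _ (intgZ 2 j2)).
  exact: measurable_rejected2.
move=> x; rewrite ger0_norm//.
by apply: Rintegral_ge0 => y _; exact: sqr_ge0.
Qed.

End rejection_bound.

(** * From the sampler on [R^d] to the abstract chain *)

Section relative_density.
Context d (T : measurableType d) (R : realType).
Variables (leb : {measure set T -> \bar R}) (Q : probability T R).
Variables (D : set T) (q : T -> R).
Hypotheses (mD : measurable D) (mq : measurable_fun D q)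
  (q_ge0 : forall x, D x -> 0 <= q x)
  (QE : forall A, measurable A -> (Q A = \int[leb]_(x in D `&` A) (q x)%:E)%E).
Implicit Types g : T -> R.

Lemma integral_rel g : measurable_fun setT g -> (forall x, 0 <= g x) ->
  (\int[Q]_x (g x)%:E = \int[leb]_(x in D) (g x * q x)%:E)%E.
Proof.
move=> mg g0.
rewrite (@integral_density _ _ _ leb Q (q \_ D))//.
- rewrite [RHS]integral_mkcond; apply: eq_integral => x _.
  by rewrite /patch; case: ifP => // _; rewrite mulr0.
- exact: (proj1 (measurable_restrictT q mD) mq).
- by move=> x; rewrite /patch; case: ifPn => // /set_mem; exact: q_ge0.
- move=> A mA; apply: (etrans (QE mA)); rewrite integral_mkcondl.
  apply: eq_integral => x _.
  by rewrite /patch; case: ifP.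
Qed.

Let intg_rel g : intg Q g -> leb.-integrable D (EFin \o (fun x => g x * q x)).
Proof.
move=> jg; have mg := intg_mfun jg.
apply/integrableP; split.
  apply/measurable_EFinP; apply: measurable_funM => //.
  exact: measurable_funS mg.
have [_] := integrableP _ _ _ jg.
have mn : measurable_fun setT (fun x => `|g x|) by exact: measurableT_comp.
rewrite (integral_rel mn)//; congr (_ < _)%E; apply: eq_integral => x /set_mem Dx /=.
by rewrite normrM (ger0_norm (q_ge0 Dx)).
Qed.

Lemma Rintegral_rel g : intg Q g ->
  \int[leb]_(x in D) (g x * q x) = \int[Q]_x g x.
Proof.
move=> jg; have mg := intg_mfun jg.
have jn : intg Q (fun x => `|g x|) by exact: integrable_norm.
have jD := intgD jg jn.
have posn (z : R) : 0 <= z + `|z| by rewrite -lerBlDl sub0r -normrN ler_norm.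
have ge0 h : intg Q h -> (forall x, 0 <= h x) ->
    \int[leb]_(x in D) (h x * q x) = \int[Q]_x h x.
  by move=> jh h0; rewrite /Rintegral integral_rel//; exact: intg_mfun jh.
transitivity (\int[leb]_(x in D) ((g x + `|g x|) * q x - `|g x| * q x)).
  by apply: eq_Rintegral => x _; ring.
rewrite RintegralB//; [|exact: (intg_rel jD)|exact: (intg_rel jn)].
rewrite (ge0 _ jD)// (ge0 _ jn)// -RintegralB//.
by apply: eq_Rintegral => x _; rewrite addrK.
Qed.

End relative_density.

Section translation.
Context (R : realType) (d : nat).
Local Notation T := (d.-tuple R).
Local Notation leb := (@lebesgue_tuple R d).
Variables (D : set T) (p q : T -> R).
Hypotheses (mD : measurable D) (mp : measurable_fun D p) (mq : measurable_fun D q)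
  (p_gt0 : forall x, D x -> 0 < p x) (q_gt0 : forall x, D x -> 0 < q x)
  (p1 : (\int[leb]_(x in D) (p x)%:E = 1)%E).
Context dO (Om : measurableType dO) (P : probability Om R).
Variables X Y : nat -> {RV P >-> T}.
Hypothesis XY : IM_chain D p q X Y.

(* The proposal distribution is read off the chain: it is the law of [Y 0]. *)
Let Q : probability T R := distribution P (Y 0%N).

(** The value 1 off [D] makes the ratio positive and at most [B] on the whole space, as the abstract
    chain requires; [Q] is carried by [D]. *)
Definition density_ratio (x : T) : R := patch (fun=> 1) D p x / patch (fun=> 1) D q x.

Let w := density_ratio.

Let DX n o : D (X n o). Proof. by have [/(_ n o)[]] := XY. Qed.
Let DY n o : D (Y n o). Proof. by have [/(_ n o)[]] := XY. Qed.

Lemma density_ratioE x : D x -> w x = p x / q x.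
Proof. by move=> Dx; rewrite /w /density_ratio /patch mem_set. Qed.

Lemma density_ratioM x : D x -> w x * q x = p x.
Proof. by move=> Dx; rewrite density_ratioE// divfK// gt_eqF// q_gt0. Qed.

Lemma density_ratio_gt0 x : 0 < w x.
Proof.
rewrite /w /density_ratio /patch; case: ifPn => [/set_mem Dx|_].
  by rewrite divr_gt0 ?p_gt0 ?q_gt0.
by rewrite divr1.
Qed.

Let measurable_patch1 (g : T -> R) : measurable_fun D g ->
  measurable_fun setT (patch (fun=> 1) D g).
Proof.
move=> mg; rewrite (_ : patch _ _ _ = fun x => (g \_ D) x + \1_(~` D) x).
  apply: measurable_funD; first exact: (proj1 (measurable_restrictT g mD) mg).
  by apply: measurable_indic; exact: measurableC.
apply/funext => x; rewrite /patch indicE in_setC.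
by case: ifP => _ /=; rewrite ?addr0 ?add0r.
Qed.

Lemma measurable_density_ratio : measurable_fun setT w.
Proof.
apply: measurable_funM; first exact: measurable_patch1.
apply: measurable_funV; first exact: measurable_patch1.
by move=> x; rewrite /patch; case: ifPn => // /set_mem; exact: q_gt0.
Qed.

Lemma acceptE x y : D x -> D y -> accept p q x y = acc w x y.
Proof.
move=> Dx Dy; rewrite /accept /acc mulr_gt0 ?p_gt0 ?q_gt0// !density_ratioE//.
have n1 : p x != 0 by rewrite gt_eqF// p_gt0.
have n2 : q x != 0 by rewrite gt_eqF// q_gt0.
have n3 : q y != 0 by rewrite gt_eqF// q_gt0.
by congr Num.min; field; rewrite ?n1 ?n2 ?n3.
Qed.

Let hist_setT n : past X Y n setT.
Proof. exact: (@hist_setT _ _ _ _ X Y n). Qed.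

Lemma proposal_law A : measurable A ->
  (Q A = \int[leb]_(x in D `&` A) (q x)%:E)%E.
Proof.
move=> mA; have [_ _ /(_ 0%N setT A setT (@hist_setT 0%N) mA measurableT)] := XY.
rewrite preimage_setT setTI setIT => E.
transitivity (P (Y 0%N @^-1` A)) => //; rewrite E.
transitivity (\int[P]_o cst (\int[leb]_(x in D `&` A) (q x)%:E) o)%E.
  apply: eq_integral => o _; apply: eq_integral => y _.
  by rewrite !indicT !mulr1 addrC subrK mulr1.
rewrite (integral_cst P measurableT) -[RHS]mule1; congr (_ * _)%E.
exact: probability_setT.
Qed.

Let q_ge0 x : D x -> 0 <= q x. Proof. by move=> /q_gt0/ltW. Qed.

Lemma integral_proposal (g : T -> R) : measurable_fun setT g -> (forall x, 0 <= g x) ->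
  (\int[Q]_x (g x)%:E = \int[leb]_(x in D) (g x * q x)%:E)%E.
Proof. exact: (integral_rel mD mq q_ge0 proposal_law). Qed.

Lemma Rintegral_proposal (g : T -> R) : intg Q g ->
  \int[leb]_(x in D) (g x * q x) = \int[Q]_x g x.
Proof. exact: (Rintegral_rel mD mq q_ge0 proposal_law). Qed.

Lemma integral_density_ratio : (\int[Q]_x (w x)%:E = 1)%E.
Proof.
rewrite integral_proposal; [|exact: measurable_density_ratio|]; last first.
  by move=> x; exact/ltW/density_ratio_gt0.
by rewrite -p1; apply: eq_integral => x /set_mem Dx; rewrite density_ratioM.
Qed.

Lemma initial_law A : measurable A ->
  (P (X 0%N @^-1` A) = \int[Q]_(x in A) (w x)%:E)%E.
Proof.
move=> mA; have [_ -> // _] := XY; rewrite /density_measure.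
have mw := measurable_density_ratio.
transitivity (\int[Q]_x (\1_A x * w x)%:E)%E; last first.
  rewrite [RHS]integral_mkcond; apply: eq_integral => x _.
  by rewrite epatch_indic/= -EFinM mulrC.
rewrite integral_proposal; last 2 first.
- exact: measurable_funM.
- by move=> x; rewrite mulr_ge0// ltW// density_ratio_gt0.
rewrite integral_mkcondr; apply: eq_integral => x /set_mem Dx.
by rewrite epatch_indic/= -EFinM -mulrA density_ratioM// mulrC.
Qed.

Lemma transition_law n H A C : hist X Y n H -> measurable A -> measurable C ->
  (P (H `&` (Y n @^-1` A) `&` (X n.+1 @^-1` C)) =
   \int[P]_(o in H) \int[Q]_(y in A)
     (acc w (X n o) y * \1_C y + (1 - acc w (X n o) y) * \1_C (X n o))%:E)%E.
Proof.
move=> hH mA mC; have [_ _ /(_ n H A C hH mA mC) ->] := XY.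
have mw := measurable_density_ratio.
apply: eq_integral => o _; set x := X n o; have Dx : D x by exact: DX.
pose h y : R := acc w x y * \1_C y + (1 - acc w x y) * \1_C x.
have ma := measurable_acc mw x.
have mh : measurable_fun setT h.
  apply: measurable_funD; apply: measurable_funM => //.
  exact: measurable_funB.
have h0 y : 0 <= h y.
  by rewrite addr_ge0// mulr_ge0// ?subr_ge0 ?acc_le1// acc_ge0//; exact: density_ratio_gt0.
transitivity (\int[Q]_y (\1_A y * h y)%:E)%E; last first.
  rewrite [RHS]integral_mkcond; apply: eq_integral => y _.
  by rewrite epatch_indic/= -EFinM mulrC.
rewrite integral_proposal; last 2 first.
- exact: measurable_funM.
- by move=> y; rewrite mulr_ge0.
rewrite integral_mkcondr; apply: eq_integral => y /set_mem Dy.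
by rewrite epatch_indic/= -EFinM /h -!acceptE//; congr EFin; ring.
Qed.

Let w_gt0 := density_ratio_gt0.
Let mw := measurable_density_ratio.

Let jw : intg Q w.
Proof.
apply/integrableP; split; first exact/measurable_EFinP.
rewrite (_ : (\int[Q]_x _)%E = 1%E) ?ltry// -integral_density_ratio.
by apply: eq_integral => x _ /=; rewrite ger0_norm// ltW// w_gt0.
Qed.

Lemma Rintegral_density_ratio : \int[Q]_x w x = 1.
Proof. by rewrite /Rintegral integral_density_ratio. Qed.

(* [KL] is a signed integral, and nothing prevents its positive part from being
   infinite a priori; only nonnegative integrals are compared below. *)
Lemma Rintegral_norm_sub1_le_KL (eps c : R) : 0 < c -> (KL D q p <= eps%:E)%E ->
  \int[Q]_x `|w x - 1| <= (2 * c)^-1 * eps + 2 * c.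
Proof.
move=> c0 KLeps.
pose phi x := q x * - ln (w x).
pose g x := w x - ln (w x).
have mln : measurable_fun setT (fun x => ln (w x)).
  by apply: measurableT_comp => //; exact: measurable_ln.
have mg : measurable_fun setT g by exact: measurable_funB.
have g0 x : 0 <= g x by rewrite subr_ge0 ltW// ln_sublinear// w_gt0.
have KLE : KL D q p = (\int[leb]_(x in D) (phi x)%:E)%E.
  apply: eq_integral => x /set_mem Dx.
  have px := p_gt0 Dx; have qx := q_gt0 Dx.
  rewrite inver gt_eqF// -EFinM lne_EFin ?divr_gt0// -EFinM; congr EFin.
  by rewrite /phi density_ratioE// -lnV ?posrE ?divr_gt0// invf_div.
have mphi : measurable_fun D phi.
  apply: measurable_funM => //; apply: measurableT_comp => //.
  exact: measurable_funS mln.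
pose a x := Num.max (phi x) 0; pose b x := Num.max (- phi x) 0.
have ma : measurable_fun D a by exact: measurable_maxr.
have mb : measurable_fun D b by apply: measurable_maxr => //; exact: measurableT_comp.
have a0 x : 0 <= a x by rewrite le_max lexx orbT.
have b0 x : 0 <= b x by rewrite le_max lexx orbT.
have KLab : KL D q p =
    (\int[leb]_(x in D) (a x)%:E - \int[leb]_(x in D) (b x)%:E)%E.
  rewrite KLE integralE; congr (_ - _)%E; apply: eq_integral => x _.
    by rewrite funeposE -EFin_max.
  by rewrite funenegE -EFinN -EFin_max.
have gE x : D x -> g x * q x + b x = a x + p x.
  move=> Dx; have -> : g x * q x = phi x + p x.
    by rewrite mulrBl density_ratioM// /phi; ring.
  by rewrite /a /b /Order.max; case: ifPn; case: ifPn; rewrite -?leNgt; lra.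
have mgq : measurable_fun D (fun x => g x * q x).
  by apply: measurable_funM => //; exact: measurable_funS mg.
have gq0 x : D x -> 0 <= g x * q x by move=> Dx; rewrite mulr_ge0// ltW// q_gt0.
have balance : (\int[leb]_(x in D) (g x * q x)%:E + \int[leb]_(x in D) (b x)%:E =
    \int[leb]_(x in D) (a x)%:E + 1)%E.
  rewrite -p1 -!ge0_integralD//.
  - by apply: eq_integral => x /set_mem Dx; rewrite -!EFinD gE.
  all: try by [exact/measurable_EFinP | move=> x Dx; rewrite lee_fin ?gq0// ltW// p_gt0].
(* Where the negative part is nonzero it is [q ln w <= q w = p]. Its integral is therefore finite
   and may be moved across the inequality on [KL]. *)
have b1 : (\int[leb]_(x in D) (b x)%:E <= 1)%E.
  rewrite -p1; apply: ge0_le_integral => //.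
  - by move=> x _; rewrite lee_fin.
  - exact/measurable_EFinP.
  - exact/measurable_EFinP.
  - move=> x Dx; rewrite lee_fin; have := gE x Dx; have := gq0 x Dx.
    have := p_gt0 Dx; rewrite /a /b /Order.max.
    by case: ifPn; case: ifPn; rewrite -?leNgt; lra.
have bfin : (\int[leb]_(x in D) (b x)%:E)%E \is a fin_num.
  by rewrite ge0_fin_numE ?(le_lt_trans b1) ?ltry// integral_ge0// => x _; rewrite lee_fin.
have gle : (\int[leb]_(x in D) (g x * q x)%:E <= (eps + 1)%:E)%E.
  have : (\int[leb]_(x in D) (a x)%:E <= eps%:E + \int[leb]_(x in D) (b x)%:E)%E.
    by rewrite -leeBlDr// -KLab.
  move: balance bfin; set IG := integral _ _ _; set IB := integral _ _ _.
  move: IG IB (integral _ _ _) => IG IB IA balance bfin ale.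
  by rewrite -(leeD2rE _ _ bfin) balance EFinD addeAC leeD2r.
rewrite -(integral_proposal mg g0) in gle.
have jg : intg Q g.
  apply/integrableP; split; first exact/measurable_EFinP.
  apply: le_lt_trans (ltry (eps + 1)); apply: le_trans gle.
  by rewrite le_eqVlt; apply/orP; left; apply/eqP; apply: eq_integral => x _ /=; rewrite ger0_norm.
have gR : \int[Q]_x g x <= eps + 1.
  by rewrite -lee_fin (EFin_Rintegral jg).
have QT : fine (Q setT) = 1 by rewrite probability_setT.
have c1 r := intg_cst Q (r : R).
have jg1 : intg Q (fun x => g x - 1) by exact: intgB.
have jw1 : intg Q (fun x => 1 + w x) by exact: intgD.
have jg2 := intgZ (2 * c)^-1 jg1; have jw2 := intgZ c jw1.
apply: (@le_trans _ _ (\int[Q]_x ((2 * c)^-1 * (g x - 1) + c * (1 + w x)))).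
  apply: le_Rintegral => //.
  - by apply: integrable_norm; exact: intgB.
  - exact: intgD.
  - move=> x _; apply: (le_trans (norm_sub1_le_ln (w_gt0 x) c0)).
    by rewrite lerD2r ler_wpM2l// invr_ge0 mulr_ge0// ltW.
rewrite RintegralD// RintegralZl// RintegralZl//.
rewrite RintegralB// [X in c * X]RintegralD// !Rintegral_cst// QT Rintegral_density_ratio.
rewrite lerD//; first by rewrite ler_wpM2l ?invr_ge0 ?mulr_ge0// ?(ltW c0)//; lra.
by rewrite mul1r mulrDr; lra.
Qed.

Variable B : R.
Hypotheses (pqB : forall x, D x -> p x <= B * q x) (B1 : 1 < B).

Let wB x : w x <= B.
Proof.
have [Dx|Dx] := pselect (D x); last first.
  by rewrite /w /density_ratio /patch memNset// divr1 ltW.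
by rewrite density_ratioE// ler_pdivrMr ?pqB// q_gt0.
Qed.

Variable F : T -> R.
Hypothesis mF : measurable_fun D F.

Let Ft := F \_ D.

Let FtE x : D x -> Ft x = F x.
Proof. by move=> Dx; rewrite /Ft /patch mem_set. Qed.

Lemma measurable_Ft : measurable_fun setT Ft.
Proof. exact: (proj1 (measurable_restrictT F mD) mF). Qed.

Lemma meanE : intg Q Ft -> mean D p F = \int[Q]_x (w x * Ft x).
Proof.
move=> jF; rewrite -(Rintegral_proposal (intgw mw w_gt0 wB B1 jF)).
apply: eq_Rintegral => x /set_mem Dx.
by rewrite mulrAC density_ratioM// FtE// mulrC.
Qed.

Lemma sigma2E : sqint Q Ft ->
  sigma2 D p F = (\int[Q]_x (w x * (Ft x - mean D p F) ^+ 2))%:E.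
Proof.
move=> sF; set m := mean D p F.
have [mFm j2] := sqintB sF (sqint_cst Q m).
have jw2 := intgw mw w_gt0 wB B1 j2.
rewrite (EFin_Rintegral jw2) integral_proposal.
- apply: eq_integral => x /set_mem Dx; congr EFin.
  by rewrite FtE// [RHS]mulrAC density_ratioM// mulrC.
- exact: intg_mfun jw2.
- by move=> x; rewrite mulr_ge0 ?sqr_ge0// ltW// w_gt0.
Qed.

(** The bound depends on [q] only through [M]. Square integrability follows from [z^2 <= 1 + z^4],
    as [Q] has finite mass. *)
Lemma fourth_moment_le (W : T -> R) (c M : R) : measurable_fun D W -> 0 <= c ->
  (forall x, D x -> `|F x| <= c * W x) -> (abs_moment D 4 q W <= M%:E)%E ->
  [/\ sqint Q Ft, intg Q (fun x => Ft x ^+ 4) &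
      \int[Q]_x (Ft x ^+ 4) <= c ^+ 4 * M].
Proof.
move=> mW c0 FW WM.
have mFt := measurable_Ft.
have mF4 : measurable_fun setT (fun x => Ft x ^+ 4) by exact: measurable_funX.
have ge4 (z : R) : 0 <= z ^+ 4 by rewrite (_ : z ^+ 4 = (z ^+ 2) ^+ 2) ?sqr_ge0//; ring.
have F4 : (\int[Q]_x (Ft x ^+ 4)%:E <= (c ^+ 4 * M)%:E)%E.
  rewrite integral_proposal//.
  have mW4 : measurable_fun D (fun x => `|W x| ^+ 4 * q x).
    by apply: measurable_funM => //; apply: measurable_funX; exact: measurableT_comp.
  apply: (@le_trans _ _ ((c ^+ 4)%:E * abs_moment D 4 q W)%E); last first.
    by rewrite (EFinM (c ^+ 4)); apply: lee_wpmul2l => //; rewrite lee_fin.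
  rewrite /abs_moment -ge0_integralZl_EFin//; last 2 first.
  - by move=> x Dx; rewrite lee_fin mulr_ge0// ltW// q_gt0.
  - exact/measurable_EFinP.
  apply: ge0_le_integral => //.
  - by move=> x Dx; rewrite lee_fin mulr_ge0// ltW// q_gt0.
  - apply/measurable_EFinP; apply: measurable_funM => //.
    exact: measurable_funS mF4.
  - by apply/measurable_EFinP; apply: measurable_funM.
  - move=> x Dx; rewrite -EFinM lee_fin mulrA ler_wpM2r ?q_ge0// FtE//.
    have cW : 0 <= c * W x by rewrite (le_trans _ (FW x Dx)).
    have -> : F x ^+ 4 = `|F x| ^+ 4.
      by rewrite -normrX ger0_norm.
    rewrite -exprMn lerXn2r ?nnegrE ?mulr_ge0// (le_trans (FW x Dx))//.
    by rewrite ler_wpM2l// ler_norm.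
have j4 : intg Q (fun x => Ft x ^+ 4).
  apply/integrableP; split; first exact/measurable_EFinP.
  apply: le_lt_trans (ltry (c ^+ 4 * M)); apply: le_trans F4.
  by rewrite le_eqVlt; apply/orP; left; apply/eqP; apply: eq_integral => x _ /=; rewrite ger0_norm.
split => //; last by rewrite -lee_fin (EFin_Rintegral j4).
split => //; apply: (le_intg _ _ (intgD (intg_cst Q 1) j4)).
  exact: measurable_funX.
move=> x; rewrite ger0_norm ?sqr_ge0//.
have := sqr_ge0 (Ft x ^+ 2 - 1); have := sqr_ge0 (Ft x); set z := Ft x; lra.
Qed.

Lemma nmse_IME (n : nat) : sqint Q Ft -> nmse_IM D p X F n =
  (n%:R^-1 * \int[P]_o ((\sum_(i < n) (Ft (X i o) - mean D p F)) ^+ 2))%:E.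
Proof.
move=> sF; set m := mean D p F.
have [_ jS] : sqint P (fun o => \sum_(i < n) (Ft (X i o) - m)).
  apply: (@sqint_sum _ _ _ P n (fun i o => Ft (X i o) - m)) => i.
  apply: (sqint_X mw w_gt0 wB B1 initial_law transition_law i (g := fun x => Ft x - m)).
  by apply: sqintB => //; exact: sqint_cst.
(* At [n = 0] both sides vanish by the convention [0^-1 = 0]. *)
rewrite /nmse_IM unlock; have [->|n0] := eqVneq n 0%N.
  by rewrite invr0 !mul0r mul0e.
have nR : n%:R != 0 :> R by rewrite pnatr_eq0.
rewrite (_ : (\int[P]_o _)%E = (\int[P]_o ((n%:R^-1 ^+ 2) *
    (\sum_(i < n) (Ft (X i o) - m)) ^+ 2)%:E)%E); last first.
  apply: eq_integral => o _; congr EFin; rewrite -exprMn; congr (_ ^+ 2).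
  rewrite /mu_IM; under eq_bigr do rewrite -(FtE (DX _ o)).
  by rewrite sumrB sumr_const card_ord mulrBr -[m *+ n]mulr_natl mulKf.
rewrite -(EFin_Rintegral (intgZ (n%:R^-1 ^+ 2) jS)) RintegralZl// -EFinM.
by congr EFin; field.
Qed.

Lemma variance_affine (S : Om -> R) (a b : R) : sqint P S -> \int[P]_o S o = 0 ->
  'V_P[fun o => a * S o + b] = (a ^+ 2 * \int[P]_o (S o ^+ 2))%:E.
Proof.
move=> sS S0; have jS := sqint_intg sS; have [_ jS2] := sS.
have PT : fine (P setT) = 1 by rewrite probability_setT.
have mean_b : fine 'E_P[fun o => a * S o + b] = b.
  rewrite unlock -/(Rintegral P setT (fun o => a * S o + b)).
  rewrite RintegralD//; [|exact: intgZ|exact: intg_cst].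
  by rewrite RintegralZl// S0 mulr0 add0r Rintegral_cst// PT mulr1.
rewrite /variance [in LHS]unlock mean_b unlock.
rewrite -RintegralZl// EFin_Rintegral; last exact: intgZ.
apply: eq_integral => o _; congr EFin.
change ((a * S o + b - b) * (a * S o + b - b) = a ^+ 2 * S o ^+ 2).
by ring.
Qed.

Lemma nvar_IMCVE (n : nat) (e := \int[Q]_x (w x * \int[Q]_y rejected w Ft (x, y))) :
  sqint Q Ft -> nvar_IMCV D p q X Y F n = (n%:R^-1 *
  \int[P]_o ((\sum_(i < n) (rejected w Ft (X i o, Y i o) - e)) ^+ 2))%:E.
Proof.
move=> sF.
have [sS S0 _] := imcv_limit mw w_gt0 wB Rintegral_density_ratio B1
  initial_law transition_law sF.
rewrite /nvar_IMCV; have [->|n0] := eqVneq n 0%N.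
  rewrite invr0 mul0r; under eq_fun do rewrite sqrtr0 mul0r.
  exact: variance_cst.
have nR : n%:R != 0 :> R by rewrite pnatr_eq0.
pose S o := \sum_(i < n) (rejected w Ft (X i o, Y i o) - e).
(* Each summand is a centred rejection term plus the constant [e + mean D q F], which drops out of
   the variance. *)
rewrite (_ : (fun o => _) = fun o => (Num.sqrt n%:R / n%:R) * S o +
    Num.sqrt n%:R * (e + mean D q F)); last first.
  apply/funext => o; rewrite /mu_IMCV -mulrA -mulrDr; congr (_ * _).
  rewrite (eq_bigr (fun i : 'I_n => (rejected w Ft (X i o, Y i o) - e) +
      (e + mean D q F))).
    by rewrite big_split/= -/(S o) sumr_const card_ord mulrDr -[(_ + _) *+ n]mulr_natl mulKf.
  move=> i _; rewrite /rejected/= -(FtE (DX _ o)) -(FtE (DY _ o)).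
  by rewrite -(acceptE (DX _ o) (DY _ o)); ring.
rewrite (variance_affine _ _ (sS n) (S0 n)); congr (_ * _)%:E.
by rewrite expr_div_n sqr_sqrtr//; field.
Qed.

Let v := \int[Q]_x (w x * \int[Q]_y (rejected w Ft (x, y) ^+ 2)).

Let Rintegral_w := Rintegral_density_ratio.

Lemma sigma2_le_IM : sqint Q Ft -> cvgn (nmse_IM D p X F) /\
  (sigma2 D p F <= sigma2_IM D p X F)%E.
Proof.
move=> sF; have nmseE : nmse_IM D p X F = EFin \o (fun n : nat => n%:R^-1 *
    \int[P]_o ((\sum_(i < n) (Ft (X i o) - mean D p F)) ^+ 2)).
  by apply/funext => n; exact: nmse_IME.
have [L [vL le_L]] := im_limit mw w_gt0 wB Rintegral_w B1 initial_law
  transition_law sF (meanE (sqint_intg sF)) (fun n => erefl).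
have cL : nmse_IM D p X F n @[n --> \oo] --> L%:E.
  by rewrite nmseE; apply: cvg_EFin vL; exact: nearW.
split; first by apply/cvg_ex; exists L%:E.
by rewrite /sigma2_IM (cvg_lim _ cL)// sigma2E// lee_fin.
Qed.

Lemma IMCV_le_rejection : sqint Q Ft -> cvgn (nvar_IMCV D p q X Y F) /\
  (sigma2_IMCV D p q X Y F <= (v * (1 + 2 * B))%:E)%E.
Proof.
move=> sF; pose e := \int[Q]_x (w x * \int[Q]_y rejected w Ft (x, y)).
have nvarE : nvar_IMCV D p q X Y F = EFin \o (fun n : nat => n%:R^-1 *
    \int[P]_o ((\sum_(i < n) (rejected w Ft (X i o, Y i o) - e)) ^+ 2)).
  by apply/funext => n; exact: nvar_IMCVE.
have [_ _ /(_ _ (fun n => erefl))[L [vL L_le]]] := imcv_limit mw w_gt0 wB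
  Rintegral_w B1 initial_law transition_law sF.
have cL : nvar_IMCV D p q X Y F n @[n --> \oo] --> L%:E.
  by rewrite nvarE; apply: cvg_EFin vL; exact: nearW.
split; first by apply/cvg_ex; exists L%:E.
by rewrite /sigma2_IMCV (cvg_lim _ cL)// lee_fin.
Qed.

(** Smallness is required only when [sigma_F^2 > 0]: it is then a matter of choosing constants,
    while [rejected_eq0] settles the case [sigma_F^2 = 0]. *)
Theorem variance_comparison (W : T -> R) (C M eps K c : R) :
  measurable_fun D W -> 0 <= C -> (forall x, D x -> `|F x| <= C * W x) ->
  (abs_moment D 4 q W <= M%:E)%E -> 0 < K -> 0 < c -> (KL D q p <= eps%:E)%E ->
  (0 < fine (sigma2 D p F) ->
     (2 * K * ((2 * c)^-1 * eps + 2 * c) + 4 * B / K * (C ^+ 4 * M)) * (1 + 2 * B)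
     <= fine (sigma2 D p F)) ->
  [/\ cvgn (nmse_IM D p X F), cvgn (nvar_IMCV D p q X Y F),
      (sigma2_IMCV D p q X Y F <= sigma2 D p F)%E &
      (sigma2 D p F <= sigma2_IM D p X F)%E].
Proof.
move=> mW C0 FW WM K0 c0 KLeps small.
have [sF j4 F4] := fourth_moment_le mW C0 FW WM.
have [c1 le1] := sigma2_le_IM sF; have [c2 le2] := IMCV_le_rejection sF.
split => //; apply: (le_trans le2).
have B0 : 0 <= 1 + 2 * B by rewrite addr_ge0// mulr_ge0// ltW// (lt_trans _ B1).
have sE := sigma2E sF.
have fs : fine (sigma2 D p F) = \int[Q]_x (w x * (Ft x - mean D p F) ^+ 2) by rewrite sE.
have s0 : 0 <= fine (sigma2 D p F).
  by rewrite fs Rintegral_ge0// => x _; rewrite mulr_ge0 ?sqr_ge0// ltW// w_gt0.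
have -> : sigma2 D p F = (fine (sigma2 D p F))%:E by rewrite fs sE.
rewrite lee_fin; move: s0; rewrite le_eqVlt => /predU1P[s0|s0].
  rewrite -s0 mulr_le0_ge0//.
  apply: (rejected_eq0 mw w_gt0 wB B1 sF (m := mean D p F)).
  by rewrite -fs -s0.
apply: (le_trans _ (small s0)); rewrite ler_wpM2r//.
apply: (le_trans (rejected_le_variation mw w_gt0 wB B1 sF j4 K0)).
have Bp : 0 < B by rewrite (lt_trans _ B1).
rewrite lerD// ler_wpM2l//.
- by rewrite mulr_ge0// ltW.
- exact: Rintegral_norm_sub1_le_KL.
- by rewrite divr_ge0 ?mulr_ge0// ltW.
Qed.

End translation.

(** * Reading the hypotheses and choosing the constants *)

Lemma gibbs_gt0 (R : realType) (d : nat) (D : set (d.-tuple R))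
    (f : d.-tuple R -> R) (Z : R) :
  prob_density D (gibbs f Z) -> forall x, 0 < gibbs f Z x.
Proof.
move=> [_ p_ge0 p1] x; rewrite /gibbs mulr_gt0 ?expR_gt0//.
rewrite ltNge; apply/negP => Z0; have /eqP := p1.
rewrite (_ : integral _ _ _ = 0%E) ?lt_eqF ?lte01//.
apply: integral0_eq => y Dy; congr EFin; apply/eqP.
by rewrite eq_le p_ge0// andbT /gibbs mulr_le0_ge0// expR_ge0.
Qed.

(** Where [q] vanishes the extended quotient of a positive number is [+oo], so a finite bound on the
    supremum also forces [q] to be positive on [D]. *)
Lemma wstar_le (R : realType) (d : nat) (D : set (d.-tuple R))
    (p q : d.-tuple R -> R) (b : R) :
  (forall x, 0 < p x) -> (forall x, D x -> 0 <= q x) -> (wstar D p q <= b%:E)%E ->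
  forall x, D x -> 0 < q x /\ p x <= b * q x.
Proof.
move=> p0 q0 wb x Dx.
have : ((p x)%:E / (q x)%:E <= b%:E)%E.
  by apply: le_trans wb; apply: ereal_sup_ubound; exists x.
rewrite inver; case: eqVneq => [_|qn0].
  by rewrite gt0_muley ?lte_fin// leye_eq.
have qp : 0 < q x by rewrite lt_neqAle eq_sym qn0 q0.
by rewrite -EFinM lee_fin ler_pdivrMr.
Qed.

Lemma in_LW_bound (R : realType) (d : nat) (D : set (d.-tuple R))
    (W F : d.-tuple R -> R) : (forall x, D x -> 1 <= W x) -> in_LW D W F ->
  exists2 C : R, 0 <= C & forall x, D x -> `|F x| <= C * W x.
Proof.
move=> W1 [_]; set S := ereal_sup _ => Soo.
exists `|fine S| => // x Dx.
have Wx : 0 < W x by rewrite (lt_le_trans ltr01)// W1.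
have : ((`|F x| / W x)%:E <= S)%E by apply: ereal_sup_ubound; exists x.
rewrite -ler_pdivrMr//; case: (S) Soo => [s| |] //= _; rewrite lee_fin => le_s.
by rewrite (le_trans le_s)// ler_norm.
Qed.

(** With [t = s / (1 + 2 B)], a large [K] brings the fourth-moment term below [t / 2]; for this [K],
    the choices of [c] and [eps] make the two remaining terms [t / 4] each. *)
Lemma small_KL_constants (R : realType) (B G s : R) : 1 < B -> 0 <= G ->
  exists eps K c, [/\ 0 < eps, 0 < K, 0 < c &
    0 < s -> (2 * K * ((2 * c)^-1 * eps + 2 * c) + 4 * B / K * G) * (1 + 2 * B) <= s].
Proof.
move=> B1 G0; have [s0|s0] := ltP 0 s; last first.
  by exists 1, 1, 1; split => // /lt_le_trans/(_ s0); rewrite ltxx.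
have BB : 0 < 1 + 2 * B by lra.
pose t := s / (1 + 2 * B); have t0 : 0 < t by rewrite divr_gt0.
pose K := 8 * B * G / t + 1.
have K0 : 0 < K.
  have B0 : 0 <= B by lra.
  by rewrite ltr_wpDl// divr_ge0 ?(ltW t0)// !mulr_ge0.
pose c := t / (16 * K); have c0 : 0 < c by rewrite divr_gt0// mulr_gt0.
exists (c * t / (4 * K)), K, c; split => //.
  by apply: divr_gt0; exact: mulr_gt0.
move=> _; rewrite -ler_pdivlMr// -/t.
have -> : 2 * K * ((2 * c)^-1 * (c * t / (4 * K)) + 2 * c) = t / 2.
  rewrite (_ : (2 * c)^-1 * (c * t / (4 * K)) = t / (8 * K)); last first.
    by field; rewrite !gt_eqF.
  by rewrite /c; field; rewrite gt_eqF.
have : 4 * B / K * G <= t / 2.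
  rewrite mulrAC ler_pdivrMr//.
  have -> : t / 2 * K = 4 * B * G + t / 2 by rewrite /K; field; rewrite gt_eqF.
  by rewrite lerDl divr_ge0// ltW.
lra.
Qed.

Theorem theorem2 (R : realType) (d : nat) (D : set (d.-tuple R))
    (f : d.-tuple R -> R) (Z : R) (F W : d.-tuple R -> R)
    (mD : measurable D)
    (mf : measurable_fun D f)
    (hpi : prob_density D (gibbs f Z))
    (W1 : forall x, D x -> 1 <= W x)
    (FW : in_LW D W F)
    (wbar mbar : R) :
  exists eps : R, 0 < eps /\
    forall q : d.-tuple R -> R,
      prob_density D q ->
      irreducible_aperiodic_unique_invariant D (IM_kernel D (gibbs f Z) q)
        (density_measure D (gibbs f Z)) ->
      in_Ln D 4 (gibbs f Z) q W ->
      (wstar D (gibbs f Z) q < +oo)%E ->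
      (wstar D (gibbs f Z) q <= wbar%:E)%E ->
      (abs_moment D 4 q W <= mbar%:E)%E ->
      (KL D q (gibbs f Z) <= eps%:E)%E ->
      forall (dO : measure_display) (Om : measurableType dO)
        (P : probability Om R) (X Y : nat -> {RV P >-> d.-tuple R}),
        IM_chain D (gibbs f Z) q X Y ->
        [/\ cvgn (nmse_IM D (gibbs f Z) X F),
            cvgn (nvar_IMCV D (gibbs f Z) q X Y F),
            (sigma2_IMCV D (gibbs f Z) q X Y F <= sigma2 D (gibbs f Z) F)%E &
            (sigma2 D (gibbs f Z) F <= sigma2_IM D (gibbs f Z) X F)%E].
Proof.
have [C C0 FC] := in_LW_bound W1 FW; have [mF _] := FW.
(* [mbar] is an arbitrary real; truncating at 0 provides the sign needed to choose the constants. *)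
pose M := Num.max mbar 0; have M0 : 0 <= M by rewrite le_max lexx orbT.
(* A strict [1 < B] puts the contraction factor [1 - 1 / B] strictly between 0 and 1, and [B] does
   not depend on [q]. *)
pose B := Num.max wbar 1 + 1; have B1 : 1 < B.
  by rewrite ltrDr (lt_le_trans ltr01)// le_max lexx orbT.
have [|eps [K [c [eps0 K0 c0 small]]]] := @small_KL_constants R B (C ^+ 4 * M)
  (fine (sigma2 D (gibbs f Z) F)) B1.
  by rewrite mulr_ge0// exprn_ge0.
exists eps; split => // q [mq q_ge0 q1] _ [mW _ _] _ wq Wq KLq dO Om P X Y XY.
have p_gt0 := gibbs_gt0 hpi; have [mp _ p1] := hpi.
have wle := wstar_le p_gt0 q_ge0 wq.
apply: (variance_comparison mD mp mq _ _ p1 XY _ B1 mF mW C0 FC _ K0 c0 KLq small).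
- by [].
- by move=> x /wle[].
- move=> x Dx; have [qx /le_trans] := wle x Dx; apply.
  by rewrite ler_wpM2r ?(ltW qx)// /B ler_wpDr// le_max lexx.
- by rewrite (le_trans Wq)// lee_fin le_max lexx.
Qed.
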